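(* Let $n\ge 2$, $k\ge 2$ be integers and let $\alpha(k)=\frac{k-1+\sqrt{(k-1)^2+4}}{2}$. Any run of a policy iteration (PI) algorithm with arbitrary action selection on an $n$-state, $k$-action deterministic MDP terminates in at most $5n^3k^2\alpha(k)^{n-1}=O(n^3k\,\alpha(k)^n)$ steps.
   Context: A (finite, discounted) MDP is a tuple $(S,A,T,R,\gamma)$ with finite state set $S$, $|S|=n\ge 2$; finite action set $A$, $|A|=k\ge 2$ (all actions available at every state); transition function $T:S\times A\times S\to[0,1]$ with $\sum_{s'}T(s,a,s')=1$; reward function $R:S\times A\to\mathbb R$; and discount factor $\gamma\in[0,1)$. It is deterministic (a DMDP) if $T$ takes values in $\{0,1\}$. A policy is a map $\pi:S\to A$. Its value function $V^\pi:S\to\mathbb R$ is the unique solution of $V^\pi(s)=R(s,\pi(s))+\gamma\sum_{s'}T(s,\pi(s),s')V^\pi(s')$. The action value function is $Q^\pi(s,a)=R(s,a)+\gamma\sum_{s'}T(s,a,s')V^\pi(s')$ and the gain is $\rho^\pi(s,a)=Q^\pi(s,a)-V^\pi(s)$. The improvable set is $I^\pi=\{(s,a):\rho^\pi(s,a)>0\}$. A valid improvement set is a nonempty $I\subseteq I^\pi$ containing at most one pair $(s,a)$ for each $s\in S$. A policy improvement step from $\pi$ using $I$ yields the policy $\pi'$ with $\pi'(s)=a$ if $(s,a)\in I$ and $\pi'(s)=\pi(s)$ otherwise. A run of a PI algorithm is a sequence of policies $\pi_1,\pi_2,\dots,\pi_\ell$ in which $\pi_1$ is an arbitrary initial policy,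 each $\pi_{i+1}$ is obtained from $\pi_i$ by a policy improvement step using some valid improvement set $I\subseteq I^{\pi_i}$, and which stops once $I^{\pi_\ell}=\emptyset$ (equivalently, $\pi_\ell$ is optimal). ''Arbitrary action selection'' means there is no restriction whatsoever on how the valid improvement sets are chosen. The number of steps of the run is counted as the number $\ell$ of policies in the sequence. The $O(\cdot)$ has an absolute constant, uniform in $n,k\ge2$. *)

(* Defs.v *)
From HB Require Import structures.
From mathcomp Require Import all_boot all_order all_algebra.
From mathcomp Require Import boolp reals.

Set Implicit Arguments.
Unset Strict Implicit.
Unset Printing Implicit Defensive.

Import Order.TTheory GRing.Theory Num.Theory.
Local Open Scope ring_scope.

Record mdp (R : realType) (S A : finType) := MDP {
  trans : S -> A -> S -> R;
  reward : S -> A -> R;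
  discount : R;
  trans_itv : forall s a s', 0 <= trans s a s' <= 1;
  trans_sum1 : forall s a, \sum_(s' : S) trans s a s' = 1;
  discount_itv : 0 <= discount < 1
}.

Definition policy (S A : finType) := {ffun S -> A}.

Section Mdp.
Variables (R : realType) (S A : finType) (M : mdp R S A).
Implicit Types (p : policy S A) (V : S -> R) (I : {set S * A}).

Definition deterministic :=
  forall s a s', trans M s a s' = 0 \/ trans M s a s' = 1.

Definition lookahead V (s : S) (a : A) : R :=
  reward M s a + discount M * \sum_(s' : S) trans M s a s' * V s'.

Definition bellman p V := forall s, V s = lookahead V s (p s).

Let subsolution0 p (D : S -> R) :
  (forall s, D s = discount M * \sum_s' trans M s (p s) s' * D s') ->
  forall s, D s = 0.
Proof.
move=> DE s0; have /andP[g0 g1] := discount_itv M.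
have [s _ smax] : exists2 s, true & forall t, `|D t| <= `|D s|.
  by case: (@arg_maxP _ _ S s0 predT (fun s => `|D s|)) => // s _ h; exists s => // t; exact: h.
suff Ds0 : `|D s| <= 0.
  by apply/eqP; rewrite -normr_le0; exact: le_trans (smax s0) Ds0.
have le_gD : `|D s| <= discount M * `|D s|.
  rewrite {1}DE normrM (ger0_norm g0); apply: ler_wpM2l => //.
  apply: (le_trans (ler_norm_sum _ _ _)).
  rewrite -[leRHS]mul1r -(trans_sum1 M s (p s)) mulr_suml.
  apply: ler_sum => t _; have /andP[t0 _] := trans_itv M s (p s) t.
  by rewrite normrM (ger0_norm t0); exact: ler_wpM2l.
rewrite -(pmulr_rle0 _ (_ : 0 < 1 - discount M)) ?subr_gt0 //.
by rewrite mulrBl mul1r subr_le0.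
Qed.

Lemma bellman_exists_unique p : exists! V, bellman p V.
Proof.
pose P := \matrix_(i < #|S|, j < #|S|)
  trans M (enum_val i) (p (enum_val i)) (enum_val j).
pose B := 1%:M - discount M *: P.
pose F (v : 'cV[R]_#|S|) s := v (enum_rank s) 0.
have PF v s : (P *m v) (enum_rank s) 0 = \sum_s' trans M s (p s) s' * F v s'.
  rewrite mxE (reindex_onto enum_rank enum_val) /=; last first.
    by move=> i _; rewrite enum_valK.
  apply: eq_big => [t|t _]; first by rewrite enum_rankK eqxx.
  by rewrite mxE !enum_rankK.
have BF v s : (B *m v) (enum_rank s) 0 =
    F v s - discount M * \sum_s' trans M s (p s) s' * F v s'.
  by rewrite mulmxBl mul1mx -scalemxAl -PF !mxE.
have uB : B \in unitmx.
  rewrite -unitmx_tr -row_free_unit; apply: inj_row_free => v vB0.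
  have Bv0 : B *m v^T = 0 by rewrite -[B]trmxK -trmx_mul vB0 trmx0.
  have Fv0 : forall s, F v^T s = 0.
    apply: (subsolution0 (p := p)) => s; apply/eqP.
    by rewrite -subr_eq0 -BF Bv0 mxE.
  apply/rowP => i; have := Fv0 (enum_val i).
  by rewrite /F enum_valK !mxE.
pose v := invmx B *m \col_i reward M (enum_val i) (p (enum_val i)).
exists (F v); split=> [s|W bW].
  have : (B *m v) (enum_rank s) 0 = reward M s (p s).
    by rewrite mulKVmx // mxE enum_rankK.
  by rewrite BF => /eqP; rewrite subr_eq => /eqP.
apply/funext => s; apply/eqP; rewrite -subr_eq0; apply/eqP.
move: s; apply: (subsolution0 (p := p)) => s.
have -> : F v s = reward M s (p s)
    + discount M * \sum_s' trans M s (p s) s' * F v s'.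
  have : (B *m v) (enum_rank s) 0 = reward M s (p s).
    by rewrite mulKVmx // mxE enum_rankK.
  by rewrite BF => /eqP; rewrite subr_eq => /eqP.
rewrite {1}bW /lookahead opprD addrACA subrr add0r -mulrBr -sumrB.
by congr (_ * _); apply: eq_bigr => t _; rewrite mulrBr.
Qed.

Definition value p : S -> R := projT1 (cid (bellman_exists_unique p)).

Definition qvalue p (s : S) (a : A) : R := lookahead (value p) s a.

Definition gain p (s : S) (a : A) : R := qvalue p s a - value p s.

Definition improvable p : {set S * A} := [set x | 0 < gain p x.1 x.2].

Definition valid_improvement p I : bool :=
  [&& I != set0, I \subset improvable p &
      [forall s : S, #|[set a | (s, a) \in I]| <= 1]%N].

Definition improve p I : policy S A :=
  [ffun s => if [pick a | (s, a) \in I] is Some a then a else p s].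

Definition pi_step : rel (policy S A) := fun p p' =>
  [exists I : {set S * A}, valid_improvement p I && (p' == improve p I)].

(* The finite run p :: ps, starting at p. *)
Definition pi_run p (ps : seq (policy S A)) : bool :=
  path pi_step p ps && (improvable (last p ps) == set0).

End Mdp.

Definition alpha (R : realType) (k : nat) : R :=
  (k%:R - 1 + Num.sqrt ((k%:R - 1) ^+ 2 + 4)) / 2.

(* Main.v *)
(* A run is counted through lassos. The value of a state s depends only on the lasso traced
   from s by the policy, that is, on the actions chosen at its branching states (those with at
   least two distinct successors) and on the rewards collected at the others. At the other
   states rewards only increase, which happens at most n (k - 1) times; between two such events
   the values of the switched states strictly increase, so no lasso is repeated.

   A lasso is a simple path s -> t followed by one of k edges, so it remains to bound the
   number of simple paths by alpha ^ (n - 1), in a multigraph where every vertex has at most k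
   outgoing edges, of which at most x = k - 1 are parallel. One may assume that each vertex has
   a heavy edge of multiplicity x and a light edge of multiplicity 1 to another vertex. Let a
   and b be their end points at s. The bound follows by induction from
   x P(a) + P(b) <= alpha W, where W is a product of vertex weights equal to alpha at full
   vertices and smaller at vertices that lost an edge: visiting a deletes the edges into a,
   which lowers the weights of their origins. If all the edges into a and b are light, the
   paths from b are further split according to whether they visit a. *)
Require Import Defs.
From mathcomp Require Import all_boot all_order all_algebra.
From mathcomp Require Import boolp reals.
From mathcomp Require Import ring lra.

Set Implicit Arguments.
Unset Strict Implicit.
Unset Printing Implicit Defensive.

Import Order.TTheory GRing.Theory Num.Theory.
Local Open Scope ring_scope.

(** * Weighted simple paths *)

Section Paths.
Variables (R : realFieldType) (V : finType) (t : V).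
Implicit Types (e : V -> V -> R) (s a b c u v : V).

(** Isolating [s] instead of removing it keeps the vertex type fixed along the recursion. *)
Definition cut e s v u := if (v == s) || (u == s) then 0 else e v u.

(* The weighted number of simple paths from s to t with at most n edges. *)
Fixpoint paths n e s : R :=
  if n is n'.+1 then
    if s == t then 1 else \sum_u e s u * paths n' (cut e s) u
  else (s == t)%:R.

Definition nonneg e := forall v u, 0 <= e v u.

Lemma cut_ge0 e s : nonneg e -> nonneg (cut e s).
Proof. by move=> e0 v u; rewrite /cut; case: ifP. Qed.

Lemma paths_ge0 n e s : nonneg e -> 0 <= paths n e s.
Proof.
elim: n e s => [|n IH] e s e0 /=; first exact: ler0n.
case: ifP => // _; apply: sumr_ge0 => u _; apply: mulr_ge0 => //.
exact/IH/cut_ge0.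
Qed.

Lemma paths_sink n e : paths n e t = 1.
Proof. by case: n => [|n] /=; rewrite eqxx. Qed.

Lemma paths_row0 n e s : s != t -> (forall u, e s u = 0) -> paths n e s = 0.
Proof.
case: n => [|n] /= /negPf -> e0 //.
by apply: big1 => u _; rewrite e0 mul0r.
Qed.

Lemma cut_row0 n e s : s != t -> paths n (cut e s) s = 0.
Proof. by move=> st; apply: paths_row0 => // u; rewrite /cut eqxx. Qed.

(** Edges out of [t], loops and edges back into the start lie on no simple path from [s] to [t], so
    they need not be compared. *)
Lemma le_paths n e e' s : nonneg e -> nonneg e' ->
  (forall v u, v != t -> u != v -> u != s -> e v u <= e' v u) ->
  paths n e s <= paths n e' s.
Proof.
elim: n e e' s => [|n IH] e e' s e0 e0' le_ee' //=.
have [//|st] := eqVneq s t.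
apply: ler_sum => u _; have [->|us] := eqVneq u s.
  by rewrite !cut_row0 // !mulr0.
apply: ler_pM => //; first exact/paths_ge0/cut_ge0.
  exact: le_ee'.
apply: IH; [exact: cut_ge0|exact: cut_ge0|move=> v w vt wv wu].
by rewrite /cut; case: ifP => // /norP[vs ws]; exact: le_ee'.
Qed.

Lemma paths_unreachable_sink n e s : nonneg e -> s != t ->
  (forall v, v != t -> e v t = 0) -> paths n e s = 0.
Proof.
elim: n e s => [|n IH] e s e0 st et0 /=; rewrite (negPf st) //.
apply: big1 => u _; have [->|ut] := eqVneq u t; first by rewrite et0 // mul0r.
rewrite IH ?mulr0 //; first exact: cut_ge0.
by move=> v vt; rewrite /cut et0 // if_same.
Qed.

(** A path that starts elsewhere never enters [b], hence uses none of the edges out of [b]. *)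
Lemma paths_unreachable n e e' s b : nonneg e -> nonneg e' -> s != b ->
  (forall v, e v b = 0) ->
  (forall v u, v != b -> v != t -> u != v -> u != s -> e v u <= e' v u) ->
  paths n e s <= paths n e' s.
Proof.
elim: n e e' s => [|n IH] e e' s e0 e0' sb eb0 le_ee' //=.
have [//|st] := eqVneq s t.
apply: ler_sum => u _; have [->|us] := eqVneq u s.
  by rewrite !cut_row0 // !mulr0.
have [->|ub] := eqVneq u b.
  by rewrite eb0 mul0r; apply: mulr_ge0 => //; exact/paths_ge0/cut_ge0.
apply: ler_pM => //; first exact/paths_ge0/cut_ge0.
  exact: le_ee'.
apply: IH => //; [exact: cut_ge0|exact: cut_ge0| |].
  by move=> v; rewrite /cut eb0 if_same.
move=> v w vb vt wv wu.
by rewrite /cut; case: ifP => // /norP[vs ws]; exact: le_ee'.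
Qed.

Definition avoid e a v u := if u == a then 0 else e v u.

Definition force (y : R) e a c v u :=
  if u == a then (if v == c then y * e c a else 0)
  else if v == c then 0 else e v u.

(* A path using the edge from c to a gains the factor y in [force y e a c];
   the paths that avoid both a and c are counted too, which only helps. *)
Lemma paths_split n e s a (D : {pred V}) (y : R) : nonneg e -> 0 < y -> s != a ->
  (forall c, c \notin D -> e c a = 0) ->
  paths n e s <= paths n (avoid e a) s
                 + \sum_(c in D) y^-1 * paths n (force y e a c) s.
Proof.
move=> e0 y0; have y0' : 0 <= y^-1 by rewrite invr_ge0 ltW.
have avoid0 e1 : nonneg e1 -> nonneg (avoid e1 a).
  by move=> h v u; rewrite /avoid; case: ifP.
have force0 e1 c : nonneg e1 -> nonneg (force y e1 a c).
  move=> h v u; rewrite /force; case: ifP => _; case: ifP => // _.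
  by rewrite mulr_ge0 // ltW.
elim: n e s D e0 => [|n IH] e s D e0 sa De /=.
  by rewrite lerDl; apply: sumr_ge0 => c _; rewrite mulr_ge0 ?ler0n.
have [st|st] := eqVneq s t.
  by rewrite lerDl; apply: sumr_ge0 => c _; rewrite mulr_ge0.
(* Once [s] has been left, no later edge into [a] can come from [s]. *)
set D' := [pred c in D | c != s].
have forceC c : c != s -> cut (force y e a c) s = force y (cut e s) a c.
  move=> cs; apply/funext => v; apply/funext => u; rewrite /cut /force.
  case: (eqVneq u a) => [->|ua].
    rewrite [a == s]eq_sym (negPf sa) !orbF (negPf cs).
    by have [->|_] := eqVneq v s; rewrite 1?eq_sym ?(negPf cs).
  by have [->|_] := eqVneq v c; rewrite ?if_same.
have avoidC : cut (avoid e a) s = avoid (cut e s) a.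
  apply/funext => v; apply/funext => u; rewrite /cut /avoid.
  by case: ifP => // _; case: ifP.
have step u : u != a -> e s u * paths n (cut e s) u <=
    e s u * paths n (cut (avoid e a) s) u
    + \sum_(c in D') y^-1 * (e s u * paths n (cut (force y e a c) s) u).
  move=> ua; have -> : \sum_(c in D') y^-1 * (e s u * paths n (cut (force y e a c) s) u)
     = e s u * \sum_(c in D') y^-1 * paths n (force y (cut e s) a c) u.
    rewrite mulr_sumr; apply: eq_bigr => c; rewrite inE => /andP[_ cs].
    by rewrite forceC // mulrCA.
  rewrite -mulrDr avoidC; apply: ler_wpM2l => //; apply: IH => //.
    exact: cut_ge0.
  move=> c; rewrite inE negb_and negbK /cut => /orP[/De->|->] //.
  by rewrite if_same.
rewrite (bigD1 a) //=.
have -> : \sum_u avoid e a s u * paths n (cut (avoid e a) s) u =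
    \sum_(u | u != a) e s u * paths n (cut (avoid e a) s) u.
  rewrite (bigD1 a) //= {1}/avoid eqxx mul0r add0r.
  by apply: eq_bigr => u ua; rewrite {1}/avoid (negPf ua).
(* A first edge into [a] is charged to the summand [c = s], where the factor [y] of that edge
   cancels [y^-1]. *)
have T1 : e s a * paths n (cut e s) a <=
    \sum_(c in D | c == s) y^-1 * \sum_u force y e a c s u * paths n (cut (force y e a c) s) u.
  have [sD|/De->] := boolP (s \in D); last first.
    rewrite mul0r; apply: sumr_ge0 => c _; rewrite mulr_ge0 //.
    apply: sumr_ge0 => u _; rewrite mulr_ge0 //; first exact: force0.
    exact/paths_ge0/cut_ge0/force0.
  rewrite (bigD1 s) ?sD ?eqxx //= (bigD1 a) //= {1}/force !eqxx.
  rewrite mulrDr !mulrA mulVf ?gt_eqF // mul1r -addrA.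
  apply: ler_wpDr; last first.
    apply: ler_wpM2l => //; apply: le_paths.
    - exact: cut_ge0.
    - exact/cut_ge0/force0.
    move=> v u vt uv ua; rewrite /cut /force (negPf ua).
    by case: ifP => // /norP[/negPf-> _].
  apply: addr_ge0.
    rewrite mulr_ge0 //; apply: sumr_ge0 => u _; rewrite mulr_ge0 //; first exact: force0.
    exact/paths_ge0/cut_ge0/force0.
  apply: sumr_ge0 => c _; rewrite mulr_ge0 //.
  apply: sumr_ge0 => u _; rewrite mulr_ge0 //; first exact: force0.
  exact/paths_ge0/cut_ge0/force0.
have T2 : \sum_(u | u != a) e s u * paths n (cut e s) u <=
   \sum_(u | u != a) e s u * paths n (cut (avoid e a) s) u +
   \sum_(c in D | c != s) y^-1 * \sum_u force y e a c s u * paths n (cut (force y e a c) s) u.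
  apply: le_trans (ler_sum _ step) _.
  rewrite big_split /= lerD2l exchange_big /=.
  apply: ler_sum => c; rewrite inE => /andP[cD cs].
  rewrite -mulr_sumr; apply: ler_wpM2l => //.
  rewrite [leRHS](bigD1 a) //= -[leLHS]add0r; apply: lerD.
    by apply: mulr_ge0; [exact: force0|exact/paths_ge0/cut_ge0/force0].
  apply: ler_sum => u ua.
  by rewrite {2}/force (negPf ua) eq_sym (negPf cs).
apply: le_trans (lerD T1 T2) _.
by rewrite addrCA [X in _ <= _ + X](bigID (pred1 s)) /=.
Qed.

Lemma paths_row_split n e e1 e2 s : nonneg e -> s != t ->
  (forall u, e s u = e1 s u + e2 s u) ->
  (forall v u, v != s -> e1 v u = e v u /\ e2 v u = e v u) ->
  paths n e s = paths n e1 s + paths n e2 s.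
Proof.
case: n => [|n] e0 st rowE othE /=; first by rewrite (negPf st) addr0.
rewrite (negPf st) -big_split /=; apply: eq_bigr => u _.
have c1 : cut e1 s = cut e s.
  apply/funext => v; apply/funext => w; rewrite /cut.
  by case: ifP => // /norP[/othE H _]; case: (H w).
have c2 : cut e2 s = cut e s.
  apply/funext => v; apply/funext => w; rewrite /cut.
  by case: ifP => // /norP[/othE H _]; case: (H w).
by rewrite c1 c2 rowE mulrDl.
Qed.

Definition setrow e v (g : V -> R) w u := if w == v then g u else e w u.

(** A simple path leaves [v] at most once, so it uses at most one entry of that row. *)
Lemma paths_row_affine n e v s : nonneg e ->
  exists (k0 : R) (k : V -> R), (forall u, 0 <= k u) /\
  forall g, paths n (setrow e v g) s = k0 + \sum_u g u * k u.
Proof.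
elim: n e s => [|n IH] e s e0 /=.
  by exists (s == t)%:R, (fun=> 0); split=> // g; rewrite big1 ?addr0 // => u _; rewrite mulr0.
have [_|st] := eqVneq s t.
  by exists 1, (fun=> 0); split=> // g; rewrite big1 ?addr0 // => u _; rewrite mulr0.
have [<-|sv] := eqVneq s v.
  exists 0, (fun u => paths n (cut e s) u); split.
    by move=> u; exact/paths_ge0/cut_ge0.
  move=> g; rewrite add0r; apply: eq_bigr => u _; rewrite {1}/setrow eqxx.
  congr (_ * paths _ _ _); apply/funext => w; apply/funext => z.
  by rewrite /cut /setrow; case: ifP => // /norP[/negPf->].
have {}IH u : {c : R * (V -> R) | (forall w, 0 <= c.2 w) /\
   forall g, paths n (cut (setrow e v g) s) u = c.1 + \sum_w g w * c.2 w}.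
  apply: cid; have [c0 [c [c_ge0 cE]]] := IH (cut e s) u (cut_ge0 s e0).
  (* Cutting [s] also erases the entry [g s], so its coefficient is set to 0. *)
  exists (c0, fun w => if w == s then 0 else c w); split=> [w /=|g /=]; first by case: ifP.
  rewrite (_ : cut _ _ = setrow (cut e s) v (fun w => if w == s then 0 else g w)).
    by rewrite cE; congr (_ + _); apply: eq_bigr => w _; case: ifP => _; rewrite ?mulr0 ?mul0r.
  apply/funext => w; apply/funext => z; rewrite /cut /setrow.
  by have [->|wv] := eqVneq w v; rewrite 1?eq_sym ?(negPf sv).
exists (\sum_u e s u * (sval (IH u)).1), (fun w => \sum_u e s u * (sval (IH u)).2 w).
split=> [w|g].
  by apply: sumr_ge0 => u _; rewrite mulr_ge0 //; case: (IH u) => c [].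
under [X in _ + X]eq_bigr do rewrite mulr_sumr.
rewrite exchange_big -big_split /=; apply: eq_bigr => u _.
rewrite {1}/setrow (negPf sv); case: (IH u) => c [_ /= ->].
by rewrite mulrDr mulr_sumr; congr (_ + _); apply: eq_bigr => w _; rewrite mulrCA.
Qed.

End Paths.

(** * Reduction to one heavy and one light edge per vertex *)

Section Extremal.
Variables (R : realFieldType) (V : finType) (t : V) (x : R).
Hypotheses (x1 : 1 <= x) (card_V : (2 <= #|V|)%N).
Implicit Types (e : V -> V -> R) (s u v : V) (h l : V -> option V).

Lemma rearrange_two (g k : V -> R) : (forall u, 0 <= g u) -> (forall u, g u <= x) ->
  \sum_u g u <= x + 1 -> (forall u, 0 <= k u) ->
  exists u1 u2, u1 != u2 /\ \sum_u g u * k u <= x * k u1 + k u2.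
Proof.
move=> g0 gx gsum k0; have [u0 _] : exists u : V, u \in V.
  by apply/card_gt0P; apply: leq_trans card_V.
case: (@arg_maxP _ _ V u0 predT k) => // u1 _ k1.
have [v0 v01] : exists v, v != u1.
  have : (0 < #|predC1 u1|)%N by rewrite cardC1 -ltnS (ltn_predK card_V).
  by case/card_gt0P => v; exists v.
case: (@arg_maxP _ _ V v0 [pred v | v != u1] k) => // u2 /= u21 k2.
exists u1, u2; split; first by rewrite eq_sym.
rewrite (bigD1 u1) //=.
have le2 : \sum_(u | u != u1) g u * k u <= (x + 1 - g u1) * k u2.
  apply: (@le_trans _ _ (\sum_(u | u != u1) g u * k u2)).
    by apply: ler_sum => u uu1; apply: ler_wpM2l => //; exact: k2.
  rewrite -mulr_suml; apply: ler_wpM2r => //.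
  by rewrite lerBrDl; move: gsum; rewrite (bigD1 u1).
have := k1 u2 isT; have := gx u1; have := k0 u2; rewrite /= => ? ? ?.
(* The difference of the two sides is at least [(x - g u1) * (k u1 - k u2)]. *)
nra.
Qed.

(* Each vertex v has a heavy edge to h v, of multiplicity x, and a light one to l v. *)
Definition edge h l v u : R := x * (h v == Some u)%:R + (l v == Some u)%:R.

Lemma edge_ge0 h l : nonneg (edge h l).
Proof. by move=> v u; rewrite addr_ge0 ?mulr_ge0 ?ler0n // (le_trans ler01). Qed.

(* The number of paths is affine in each row, so it is maximal at an extreme point of the
   polytope of admissible rows. *)
Lemma paths_extremal n e s : nonneg e -> (forall v u, e v u <= x) ->
  (forall v, \sum_u e v u <= x + 1) ->
  exists h l, (forall v, h v != l v) /\ paths t n e s <= paths t n (edge h l) s.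
Proof.
move=> e0 ex esum.
(* Rows are replaced one at a time along [enum V]; the last clause keeps the untouched rows equal to
   those of [e]. *)
suff [e' [e'0 le_ee' e'E _]] : exists e', [/\ nonneg e', paths t n e s <= paths t n e' s,
   (forall v, v \in enum V -> exists u12 : V * V, u12.1 != u12.2 /\
     forall u, e' v u = x * (u12.1 == u)%:R + (u12.2 == u)%:R) &
   (forall v, v \notin enum V -> e' v = e v)].
  have {}e'E v := cid (e'E v (mem_enum V v)).
  exists (fun v => Some (sval (e'E v)).1), (fun v => Some (sval (e'E v)).2).
  split=> [v|]; first by have [] := svalP (e'E v).
  rewrite (_ : edge _ _ = e') //; apply/funext => v; apply/funext => u.
  by rewrite /edge; have [_ ->] := svalP (e'E v).
elim: (enum V) => [|v vs [e' [e'0 le_ee' e'E e'e]]]; first by exists e; split.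
have [v_vs|v_vs] := boolP (v \in vs).
  exists e'; split=> // w; rewrite inE; last by rewrite negb_or => /andP[_ /e'e].
  by case/orP => [/eqP->|]; exact: e'E.
have [k0 [k [k_ge0 kE]]] := paths_row_affine t n v s e'0.
have [||||u1 [u2 [u12 le_k]]] := @rearrange_two (e' v) k => //.
- by rewrite e'e.
- by rewrite e'e.
pose g u := x * (u1 == u)%:R + (u2 == u)%:R.
exists (setrow e' v g); split.
- move=> w u; rewrite /setrow; case: ifP => // _.
  by rewrite /g addr_ge0 ?mulr_ge0 ?ler0n // (le_trans ler01).
- apply: (le_trans le_ee'); rewrite kE.
  have -> : e' = setrow e' v (e' v).
    by apply/funext => w; apply/funext => u; rewrite /setrow; case: eqP => [->|].
  rewrite kE lerD2l; apply: (le_trans le_k).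
  rewrite (bigD1 u1) //= (bigD1 u2) /= 1?eq_sym //.
  rewrite big1 ?addr0 => [|u /andP[uu1 uu2]].
    by rewrite /g !eqxx (negPf u12) [u2 == u1]eq_sym (negPf u12) mulr0 mulr1 addr0 add0r mul1r.
  by rewrite /g eq_sym (negPf uu1) eq_sym (negPf uu2) mulr0 addr0 mul0r.
- move=> w; rewrite inE; have [->|wv] /= := eqVneq w v.
    by move=> _; exists (u1, u2); split=> // u; rewrite /setrow eqxx.
  by move=> /e'E [uu [? H]]; exists uu; split=> // u; rewrite /setrow (negPf wv) H.
- move=> w; rewrite inE negb_or => /andP[wv /e'e <-].
  by apply/funext => u; rewrite /setrow (negPf wv).
Qed.

End Extremal.

(** * Vertex weights *)

Section Weights.
Variables (R : realFieldType) (V : finType) (t : V) (x al p q : R).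
Hypotheses (x1 : 1 <= x) (q1 : 1 <= q) (qp : q <= p) (xp : x <= p) (pal : p <= al).
Implicit Types (f h l : V -> option V) (a b c d s u v : V) (F : V -> R).

Definition drop a f v := if f v == Some a then None else f v.

(** Applied to vertices that cannot be visited: losing both edges brings their weight down to 1. *)
Definition mute b f v := if v == b then None else f v.

Definition wf h l :=
  [/\ forall v, [&& h v != Some v, l v != Some v & (h v == l v) ==> (h v == None)],
      h t = None & l t = None].

Definition subgraph f' f := forall v, f' v = f v \/ f' v = None.

Lemma drop_sub a f : subgraph (drop a f) f.
Proof. by move=> v; rewrite /drop; case: ifP; [right|left]. Qed.

Lemma mute_sub b f : subgraph (mute b f) f.
Proof. by move=> v; rewrite /mute; case: ifP; [right|left]. Qed.

Lemma sub_trans f1 f2 f3 : subgraph f1 f2 -> subgraph f2 f3 -> subgraph f1 f3.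
Proof. by move=> f12 f23 v; case: (f12 v) => ->; [exact: f23|right]. Qed.

Lemma wf_sub h l h' l' : wf h l -> subgraph h' h -> subgraph l' l -> wf h' l'.
Proof.
case=> nl ht lt hh ll; split.
- move=> v; have /and3P[hv lv hl] := nl v.
  case: (hh v) => ->; case: (ll v) => ->; rewrite ?eqxx ?implybT ?hv ?lv //=.
  exact/implyP.
- by case: (hh t) => ->.
- by case: (ll t) => ->.
Qed.

(* A vertex that still has both its heavy edge h v and its light edge l v weighs al;
   deleting edges, as happens to the predecessors of a visited vertex, lowers the weight. *)
Definition weight h l v : R :=
  match h v, l v with
  | Some _, Some _ => al | Some _, None => p | None, Some _ => q | None, None => 1
  end.

(** The share of the first vertex of a path: the multiplicity of a lone edge, [al] for a full vertex
    by the pair inequality, 0 for a dead end, and 1 at the sink for the empty path. *)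
Definition start h l v : R :=
  if v == t then 1 else
  match h v, l v with
  | Some _, Some _ => al | Some _, None => x | None, Some _ => 1 | None, None => 0
  end.

Definition total h l := \prod_v weight h l v.

Let p1 : 1 <= p := le_trans q1 qp.
Let al1 : 1 <= al := le_trans p1 pal.

Lemma weight_ge1 h l v : 1 <= weight h l v.
Proof. by rewrite /weight; case: (h v); case: (l v). Qed.

Lemma weight_ge0 h l v : 0 <= weight h l v.
Proof. exact: le_trans ler01 (weight_ge1 h l v). Qed.

Lemma total_ge1 h l : 1 <= total h l.
Proof.
rewrite /total; elim/big_rec: _ => // v y _ y1.
by apply: mulr_ege1 => //; exact: weight_ge1.
Qed.

Lemma total_ge0 h l : 0 <= total h l.
Proof. exact: le_trans ler01 (total_ge1 h l). Qed.

Lemma start_le_weight h l v : start h l v <= weight h l v.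
Proof. by rewrite /start /weight; case: eqP => _; case: (h v); case: (l v). Qed.

Lemma le_weight h l h' l' v : h' v = h v \/ h' v = None -> l' v = l v \/ l' v = None ->
  weight h' l' v <= weight h l v.
Proof.
move=> hh ll; rewrite /weight.
have q_al := le_trans qp pal.
by case: hh => ->; case: ll => ->; case: (h v); case: (l v).
Qed.

Lemma le_start h l h' l' v : h' v = h v \/ h' v = None -> l' v = l v \/ l' v = None ->
  start h' l' v <= start h l v.
Proof.
move=> hh ll; rewrite /start; case: eqP => // _.
have x_al := le_trans xp pal; have x0 := le_trans ler01 x1.
have al0 := le_trans ler01 al1.
by case: hh => ->; case: ll => ->; case: (h v); case: (l v).
Qed.

(** Loss factors are functions on vertices, so that losses at several vertices multiply; this one is
    a loss at the single vertex [c]. *)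
Definition only c (y : R) v : R := if v == c then y else 1.

Lemma prod_only c y : \prod_v only c y v = y.
Proof. by rewrite -big_mkcond big_pred1_eq. Qed.

Lemma only_ge0 c y v : 0 <= y -> 0 <= only c y v.
Proof. by rewrite /only; case: ifP. Qed.

(** * The induction step on the length of paths *)

Section Step.
Variable n : nat.
Hypothesis bound : forall h l s, wf h l ->
  paths t n (edge x h l) s <= start h l s * \prod_(v | v != s) weight h l v.

(** [F v] bounds the ratio of the new weight of [v] to the old one; at the origin [a] the new weight
    is [start]. *)
Lemma bound_by h l h' l' a F : wf h' l' -> (forall v, 0 <= F v) ->
  (forall v, v != a -> weight h' l' v <= F v * weight h l v) ->
  start h' l' a <= F a * weight h l a ->
  paths t n (edge x h' l') a <= \prod_v F v * total h l.
Proof.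
move=> wf' F0 leF leFa; apply: le_trans (bound a wf') _.
rewrite /total -big_split /= [leRHS](bigD1 a) //=.
have s0 : 0 <= start h' l' a.
  rewrite /start; case: ifP => // _; have := al1.
  by case: (h' a); case: (l' a) => //= *; rewrite ?(le_trans ler01).
apply: ler_pM => //; first by apply: prodr_ge0 => v _; exact: weight_ge0.
by apply: ler_prod => v va; rewrite weight_ge0 leF.
Qed.

Lemma paths_drop h l a :
  paths t n (edge x h l) a <= paths t n (edge x (drop a h) (drop a l)) a.
Proof.
apply: le_paths; try exact: edge_ge0.
move=> v u _ _ ua; rewrite /edge /drop.
have aux f : (f v == Some u) = ((if f v == Some a then None else f v) == Some u).
  by have [->|//] := eqVneq (f v) (Some a); apply/eqP => -[au]; rewrite au eqxx in ua.
by rewrite -!aux.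
Qed.

Lemma bound_drop h l h' l' a F : wf h' l' -> (forall v, 0 <= F v) ->
  (forall v, v != a -> weight (drop a h') (drop a l') v <= F v * weight h l v) ->
  start h' l' a <= F a * weight h l a ->
  paths t n (edge x h' l') a <= \prod_v F v * total h l.
Proof.
move=> wf' F0 leF leFa; apply: le_trans (paths_drop h' l' a) _.
apply: bound_by => //; first by apply: wf_sub wf' _ _; exact: drop_sub.
by apply: le_trans leFa; apply: le_start; exact: drop_sub.
Qed.

(** For a predecessor [c] of [a]: the edge from [c] into the origin [a] is unusable, so [c] may be
    weighed without it. *)
Lemma bound_loss h l a c y : wf h l -> 0 <= y -> c != a ->
  weight (drop a h) (drop a l) c <= y * weight h l c ->
  paths t n (edge x h l) a <= y * total h l.
Proof.
move=> wfhl y0 ca lec; rewrite -{1}(prod_only c y).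
apply: bound_drop => // [v|v va|]; first exact: only_ge0.
  rewrite /only; case: eqP => [->//|_]; rewrite mul1r.
  by apply: le_weight; exact: drop_sub.
by rewrite /only eq_sym (negPf ca) mul1r start_le_weight.
Qed.

Lemma bound_start h l a y : wf h l -> 0 <= y ->
  start h l a <= y * weight h l a ->
  paths t n (edge x h l) a <= y * total h l.
Proof.
move=> wfhl y0 lea; rewrite -{1}(prod_only a y).
apply: bound_by => // [v|v va|]; rewrite /only; first by case: ifP.
  by rewrite (negPf va) mul1r.
by rewrite eqxx.
Qed.

Lemma bound_weight h l a : wf h l -> paths t n (edge x h l) a <= total h l.
Proof.
move=> wfhl; rewrite -[leRHS]mul1r; apply: bound_start => //.
by rewrite mul1r start_le_weight.
Qed.

Definition orphan h l b := forall v, (h v != Some b) && (l v != Some b).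

Lemma edge_orphan h l b v : orphan h l b -> edge x h l v b = 0.
Proof. by move=> /(_ v) /andP[/negPf e1 /negPf e2]; rewrite /edge e1 e2 mulr0 addr0. Qed.

(** No path from [a] enters the orphan [b], so [b] can be muted. Its weight becomes 1, and [F b] may
    be as small as the inverse of its old weight. *)
Lemma bound_orphan h l h' l' a b F : wf h' l' -> orphan h' l' b -> b != t -> a != b ->
  (forall v, 0 <= F v) -> 1 <= F b * weight h l b ->
  (forall v, v != a -> v != b -> weight h' l' v <= F v * weight h l v) ->
  start h' l' a <= F a * weight h l a ->
  paths t n (edge x h' l') a <= \prod_v F v * total h l.
Proof.
move=> wf' orph bt ab F0 leFb leF leFa.
apply: (@le_trans _ _ (paths t n (edge x (mute b h') (mute b l')) a)).
  apply: (@paths_unreachable _ _ _ _ _ _ _ b) => //; try exact: edge_ge0.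
    by move=> v; exact: edge_orphan.
  by move=> v u vb _ _ _; rewrite /edge /mute (negPf vb).
apply: bound_by => //; first by apply: wf_sub wf' _ _; exact: mute_sub.
  move=> v va; have [->|vb] := eqVneq v b.
    by rewrite {1}/weight /mute eqxx.
  by rewrite {1}/weight /mute (negPf vb) leF.
by apply: le_trans leFa; apply: le_start; exact: mute_sub.
Qed.

Lemma bound_orphan1 h l a b y : wf h l -> orphan h l b -> a != b -> 0 <= y ->
  b != t -> 1 <= y * weight h l b ->
  paths t n (edge x h l) a <= y * total h l.
Proof.
move=> wfhl orph ab y0 bt leb; rewrite -{1}(prod_only b y).
apply: (bound_orphan (b := b)) => // [v|||]; rewrite /only ?eqxx //.
- by case: ifP.
- by move=> v va /negPf->; rewrite mul1r.
- by rewrite (negPf ab) mul1r start_le_weight.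
Qed.

Lemma orphan_sink h l a : orphan h l t -> a != t -> paths t n (edge x h l) a = 0.
Proof.
move=> orph at_; apply: paths_unreachable_sink => //; first exact: edge_ge0.
by move=> v _; exact: edge_orphan.
Qed.

(* These hypotheses hold for p = (x ^+ 2 + 1) / al and q = 1 + al^-1 when 2 <= x. *)
Section LargeOutdegree.
Let rho := p / al.
Hypothesis quick_le : x / q + 1 <= al.
Hypothesis q_loss : q / al <= q^-1.
Hypothesis orphan_full : x + al^-1 <= al.
Hypothesis orphan_heavy : x * (x / p) + p^-1 <= al.
Hypothesis heavy_full : x * rho + q / al <= al.
Hypothesis heavy_only : x * rho + p^-1 <= al.
Hypothesis row_le : rho * (x / p + 1) / al <= q^-1.
Hypothesis qV_rho : q^-1 <= rho.
Hypothesis split_full : forall r : nat, (0 < r)%N ->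
  x * rho ^+ r + rho ^+ r.+1 * (al^-1 + r%:R / x) <= al.
Hypothesis split_heavy : forall r : nat, (0 < r)%N ->
  x * (rho ^+ r * (x / p)) + rho ^+ r.+1 * (p^-1 + r%:R / x) <= al.

Let x0 : 0 < x := lt_le_trans ltr01 x1.
Let q0 : 0 < q := lt_le_trans ltr01 q1.
Let p0 : 0 < p := lt_le_trans ltr01 p1.
Let al0 : 0 < al := lt_le_trans ltr01 al1.
Let rho0 : 0 <= rho.
Proof. by rewrite divr_ge0 // ltW. Qed.
Let rho_al : rho * al = p.
Proof. by rewrite divfK ?gt_eqF. Qed.
Let rho_q : 1 <= rho * q.
Proof. by rewrite -ler_pdivrMr // mul1r. Qed.

(** A full vertex drops from [al] to at most [p = rho * al], a vertex with only a light edge from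
    [q] to 1, which is at most [rho * q]. *)
Lemma weight_light_lost h l h' l' v : l v != None -> l' v = None ->
  h' v = h v \/ h' v = None -> weight h' l' v <= rho * weight h l v.
Proof.
rewrite /weight => lv -> hh; case: (l v) lv => // u _.
by case: hh => ->; case: (h v) => [w|] //; rewrite ?rho_al ?qp.
Qed.

(* A path from b either avoids a, or enters a by the light edge of a full vertex c;
   in the latter case c is turned into a vertex whose only edge is heavy. *)
Lemma split_bound h l a b d (iw : R) : wf h l -> a != b ->
  (forall c, h c != Some a) -> (forall c, h c != Some b) ->
  (forall c, l c == Some a -> h c != None) ->
  d != a -> l d != Some a ->
  (d != b /\ l d = Some b) \/ [/\ d = b, h b = None & l b != None] ->
  0 <= iw -> (a != t -> 1 <= iw * weight h l a) ->
  paths t n (edge x h l) b <= rho ^+ #|[pred c | l c == Some a]|.+1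
    * (iw + #|[pred c | l c == Some a]|%:R / x) * total h l.
Proof.
set r := #|_|.
move=> wfhl ab ha hb la da lda dP iw0 iwa.
have [nl ht lt] := wfhl.
have Sab : (Some a == Some b) = false by rewrite (inj_eq Some_inj) (negPf ab).
(* Every light edge into [a] yields one [rho]. One more comes from [d], which loses its light edge
   into [b] or is [b] itself, where [start] is at most 1 while the weight is [q]. *)
pose F v := (if l v == Some a then rho else 1) * only d rho v.
have F0 v : 0 <= F v by rewrite /F mulr_ge0 ?only_ge0 //; case: ifP.
have prodF : \prod_v F v = rho ^+ r.+1.
  by rewrite /F big_split prod_only -big_mkcond prodr_const exprSr.
apply: le_trans (paths_drop h l b) _.
set h1 := drop b h; set l1 := drop b l.
have lb_na : d = b -> l b != Some a by move=> <-.
have lossF h' l' v : h' v = h v \/ h' v = None ->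
    l' v = drop a l1 v -> d != b \/ v != b -> weight h' l' v <= F v * weight h l v.
  move=> hh ll db_vb; rewrite /F /only.
  have [lva|lva] := eqVneq (l v) (Some a).
    have [vd|_] := eqVneq v d; first by rewrite -vd lva eqxx in lda.
    rewrite mulr1; apply: weight_light_lost => //; first by rewrite lva.
    by rewrite ll /drop /l1 /drop lva Sab eqxx.
  rewrite mul1r; have [vd|vd] := eqVneq v d; last first.
    rewrite mul1r; apply: le_weight => //; rewrite ll.
    exact: (sub_trans (drop_sub _ _) (drop_sub _ _)).
  have ldb : l d = Some b by case: dP => [[]|[db _ _]] //; move: db_vb; rewrite vd db eqxx => -[].
  by apply: weight_light_lost => //; rewrite ?ll vd ?ldb // /drop /l1 /drop ldb !eqxx.
have startF h' l' : h' b = h b \/ h' b = None -> l' b = drop a l1 b ->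
    start h' l' b <= F b * weight h l b.
  move=> hh ll; case: dP => [[db _]|[db hbN lbN]].
    by apply: le_trans (start_le_weight _ _ _) _; apply: lossF => //; left.
  rewrite /F /only db eqxx (negPf (lb_na db)) mul1r.
  have ->: rho * weight h l b = rho * q by rewrite /weight hbN; case: (l b) lbN.
  have bt : b != t by apply: contra_neq lbN => ->.
  rewrite /start (negPf bt); case: hh => ->; rewrite ?hbN; case: (l' b) => *;
    by rewrite ?rho_q // mulr_ge0 // ltW.
have sub2 f : subgraph (drop a (drop b f)) f.
  exact: (sub_trans (drop_sub _ _) (drop_sub _ _)).
have ba : b != a by rewrite eq_sym.
apply: le_trans (paths_split t n (D := [pred c | l c == Some a]) _ x0 ba _) _.
- exact: edge_ge0.
- move=> c; rewrite inE => lca; rewrite /edge /h1 /l1 /drop.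
  have -> : ((if h c == Some b then None else h c) == Some a) = false.
    by case: ifP => // _; exact: (negPf (ha c)).
  have -> : ((if l c == Some b then None else l c) == Some a) = false.
    by case: ifP => // _; exact: (negPf lca).
  by rewrite mulr0 addr0.
(* Paths avoiding [a] gain [iw] because [a] becomes an orphan; the others give [r] summands with
   coefficient [x^-1]. *)
rewrite mulrDr [in leRHS]mulrDl; apply: lerD.
  apply: (@le_trans _ _ (paths t n (edge x (drop a h1) (drop a l1)) b)).
    apply: le_paths; [|exact: edge_ge0|].
      by move=> v u; rewrite /avoid; case: ifP => // _; exact: edge_ge0.
    move=> v u _ _ _; rewrite /avoid; case: ifP => [_|ua]; first exact: edge_ge0.
    rewrite /edge; have aux f : (f v == Some u) = (drop a f v == Some u).
      rewrite /drop; have [->|//] := eqVneq (f v) (Some a).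
      by apply/eqP => -[au]; rewrite au eqxx in ua.
    by rewrite -!aux.
  have orph : orphan (drop a h1) (drop a l1) a.
    move=> v; apply/andP; split; rewrite /drop.
      by case: ifP => // /negbT.
    by have [|//] := eqVneq (l1 v) (Some a).
  have [a_t|at_] := eqVneq a t.
    have bt : b != t by rewrite -a_t.
    have W0 := total_ge0 h l; rewrite a_t in orph *.
    by rewrite (orphan_sink orph bt) !mulr_ge0 ?exprn_ge0.
  rewrite -prodF -(prod_only a iw) -big_split.
  apply: (bound_orphan (b := a)) => //.
  - by apply: wf_sub wfhl _ _; exact: sub2.
  - by move=> v; rewrite mulr_ge0 // only_ge0.
  - rewrite /F /only eqxx [a == d]eq_sym (negPf da) mulr1.
    have -> : (l a == Some a) = false by have /and3P[_ /negPf] := nl a.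
    by rewrite /= mul1r iwa.
  - move=> v vb va; rewrite /only (negPf va) /= mulr1.
    by apply: lossF => //; [exact: sub2|right].
  - rewrite /only (negPf ba) /= mulr1; apply: startF => //; exact: sub2.
have -> : rho ^+ r.+1 * (r%:R / x) * total h l =
    \sum_(c in [pred c | l c == Some a]) x^-1 * (rho ^+ r.+1 * total h l).
  by rewrite sumr_const -/r -mulr_natl; ring.
apply: ler_sum => c; rewrite inE => /eqP lca.
apply: ler_wpM2l; first by rewrite invr_ge0 ltW.
have ca : c != a by apply: contra_eq_neq lca => ->; have /and3P[_ + _] := nl a.
have cd : c != d by apply: contra_eq_neq lca => ->.
(* Amplified by [x], the light edge from [c] to [a] is a heavy one, and [force] has removed the
   other edge of [c]. *)
pose h2 v := if v == c then Some a else drop a h1 v.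
pose l2 v := if v == c then None else drop a l1 v.
apply: (@le_trans _ _ (paths t n (edge x h2 l2) b)).
  apply: le_paths; [|exact: edge_ge0|].
    move=> v u; rewrite /force; case: ifP => _; case: ifP => // _; last exact: edge_ge0.
    by rewrite mulr_ge0 ?edge_ge0 // ltW.
  move=> v u vt uv ub; rewrite /force; case: ifP => [/eqP ->|ua].
    case: ifP => [/eqP ->|_]; last exact: edge_ge0.
    rewrite /edge /h2 /l2 /h1 /l1 eqxx /drop eqxx.
    have -> : ((if h c == Some b then None else h c) == Some a) = false.
      by case: ifP => // _; exact: (negPf (ha c)).
    have -> : ((if l c == Some b then None else l c) == Some a) = true.
      by rewrite lca Sab eqxx.
    by rewrite mulr0 add0r addr0 !mulr1.
  case: ifP => [_|vc]; first exact: edge_ge0.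
  rewrite /edge /h2 /l2 vc; have aux f : (f v == Some u) = (drop a f v == Some u).
    rewrite /drop; have [->|//] := eqVneq (f v) (Some a).
    by apply/eqP => -[au]; rewrite au eqxx in ua.
  by rewrite -!aux.
have Fc : weight h2 l2 c <= F c * weight h l c.
  rewrite /F /only lca eqxx (negPf cd) mulr1 /weight /h2 /l2 eqxx lca.
  by case: (h c) (la c) => [w|]; rewrite ?rho_al // lca eqxx => /(_ isT).
have leF v : d != b \/ v != b -> weight h2 l2 v <= F v * weight h l v.
  have [->//|vc] := eqVneq v c.
  by move=> db; apply: lossF => //; rewrite /h2 /l2 (negPf vc) //; exact: sub2.
rewrite -prodF; apply: bound_by => //.
- split=> [v||]; rewrite /h2 /l2.
  + have [->|_] := eqVneq v c.
      by rewrite (inj_eq Some_inj) eq_sym ca.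
    have [nl2 _ _] : wf (drop a h1) (drop a l1) by apply: wf_sub wfhl _ _; exact: sub2.
    exact: nl2.
  + rewrite ifN; last by apply: contra_eq_neq lca => <-; rewrite lt.
    by case: (sub2 h t) => ->.
  + by case: ifP => // _; case: (sub2 l t) => ->.
- by move=> v vb; apply: leF; right.
- have [bc|bc] := eqVneq b c.
    apply: le_trans (start_le_weight _ _ _) _; apply: leF; left.
    by rewrite bc eq_sym.
  by apply: startF; rewrite /h2 /l2 (negPf bc) //; exact: sub2.
Qed.

(* When a is the only way into b, a path from a whose first edge is heavy misses b. *)
Lemma row_bound h l a b c : wf h l -> a != b ->
  (forall v, h v != Some a) -> (forall v, h v != Some b) ->
  (forall v, l v = Some b -> v = a) -> a != t -> h a != None -> l a = Some b ->
  l c = Some a -> (b != t -> p <= weight h l b) -> (c = b -> h b != None) ->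
  paths t n (edge x h l) a <= q^-1 * total h l.
Proof.
move=> wfhl ab ha hb lb at_ ha0 lab lca wb cb.
have [nl ht lt] := wfhl.
have ca : c != a by apply: contra_eq_neq lca => ->; have /and3P[_ + _] := nl a.
have Wge0 := total_ge0 h l.
have wa : weight h l a = al by rewrite /weight lab; case: (h a) ha0.
have mute_off f : mute a f a = None by rewrite /mute eqxx.
(* Paths are split according to whether their first edge is heavy or light. *)
have split_le : paths t n (edge x h l) a
    <= paths t n (edge x h (mute a l)) a + paths t n (edge x (mute a h) l) a.
  rewrite le_eqVlt; apply/orP; left; apply/eqP; apply: paths_row_split => //.
  - exact: edge_ge0.
  - by move=> u; rewrite /edge !mute_off /= mulr0 addr0 add0r.
  - by move=> v u va; rewrite /edge /mute (negPf va).
apply: le_trans split_le _.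
have wfA : wf h (mute a l) by apply: wf_sub wfhl _ (mute_sub _ _); left.
have wfB : wf (mute a h) l by apply: wf_sub wfhl (mute_sub _ _) _; left.
have drop_c h' l' v : h' v = h v \/ h' v = None -> l' v = l v \/ l' v = None ->
    v != a -> weight (drop a h') (drop a l') v <= only c rho v * weight h l v.
  move=> hh ll va.
  have hd : drop a h' v = h v \/ drop a h' v = None.
    by rewrite /drop; case: ifP => _; [right|].
  rewrite /only; case: eqP => [vc|_].
    apply: weight_light_lost => //; first by rewrite vc lca.
    by case: ll; rewrite /drop ?vc ?lca => ->; rewrite ?eqxx //; case: ifP.
  rewrite mul1r; apply: le_weight => //.
  by rewrite /drop; case: ifP => _; [right|].
(* Light first edge: [c] loses its light edge into [a], and the origin counts 1 instead of [al]. *)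
have le2 : paths t n (edge x (mute a h) l) a <= rho / al * total h l.
  apply: (@le_trans _ _ ((\prod_v (only c rho v * only a al^-1 v)) * total h l)).
    apply: bound_drop => // [v|v va|].
    - by rewrite mulr_ge0 ?only_ge0 // invr_ge0 ltW.
    - rewrite {2}/only (negPf va) mulr1; apply: drop_c => //; last by left.
      exact: mute_sub.
    - rewrite /only eq_sym (negPf ca) eqxx mul1r wa mulVf ?gt_eqF //.
      by rewrite /start (negPf at_) mute_off lab.
  by rewrite big_split !prod_only.
have le1 : paths t n (edge x h (mute a l)) a <= rho * (x / p) / al * total h l.
  apply: le_trans (paths_drop _ _ _) _.
  have orph : orphan (drop a h) (drop a (mute a l)) b.
    move=> v; apply/andP; split; rewrite /drop; first by case: ifP.
    case: ifP => // _; rewrite /mute; case: ifP => // /eqP va.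
    by apply/eqP => /lb.
  have [bt|bt] := eqVneq b t.
    rewrite bt in orph; rewrite orphan_sink //.
    by rewrite !mulr_ge0 ?invr_ge0 // ltW.
  have rp : rho / p = al^-1 by rewrite /rho mulrAC divff ?mul1r ?gt_eqF.
  apply: (@le_trans _ _ ((\prod_v (only c rho v * only b p^-1 v * only a (x / al) v)) * total h l)).
    apply: (bound_orphan (b := b)) => // [|v|||].
    - by apply: wf_sub wfA _ _; exact: drop_sub.
    - by rewrite !mulr_ge0 ?only_ge0 // ?mulr_ge0 ?invr_ge0 // ltW.
    - rewrite /only eqxx [b == a]eq_sym (negPf ab) mulr1.
      (* If [c = b], both factors fall on [b] and multiply to [al^-1], which is affordable because
         [b] is then full. *)
      have [bc|_] := eqVneq b c; last by rewrite mul1r mulrC ler_pdivlMr // mul1r wb.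
      rewrite rp; have -> : weight h l b = al.
        by rewrite /weight {2}bc lca; case: (h b) (cb (esym bc)).
      by rewrite mulVf // gt_eqF.
    - move=> v va vb; rewrite {2 3}/only (negPf va) (negPf vb) !mulr1.
      by apply: drop_c => //; [left|exact: mute_sub].
    - rewrite /only eqxx (negPf ab) eq_sym (negPf ca) !mul1r wa divfK ?gt_eqF //.
      by rewrite /start (negPf at_) /drop mute_off (negPf (ha a)); case: (h a) ha0.
  by rewrite !big_split !prod_only /= (_ : rho / p * (x / al) = rho * (x / p) / al) //; field; rewrite !gt_eqF.
apply: le_trans (lerD le1 le2) _.
rewrite -mulrDl; apply: ler_wpM2r => //.
by apply: le_trans row_le; rewrite mulrDr mulr1 mulrDl.
Qed.

(** The cases exhaust the ways of saving weight: a vertex that no edge enters, a heavy edge lost to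
    [a] or [b], an edge missing at the origin. The configurations left have only light edges into
    [a] and [b]; [split_bound] or [row_bound] settles them. *)
Lemma pair_large h l a b : wf h l -> a != b ->
  x * paths t n (edge x h l) a + paths t n (edge x h l) b <= al * total h l.
Proof.
move=> wfhl ab; have [nl ht lt] := wfhl; have Wge0 := total_ge0 h l.
have ba : b != a by rewrite eq_sym.
have xal : x <= al := le_trans xp pal.
have leA := bound_weight a wfhl; have leB := bound_weight b wfhl.
have combine y z : paths t n (edge x h l) a <= y * total h l ->
    paths t n (edge x h l) b <= z * total h l -> x * y + z <= al ->
    x * paths t n (edge x h l) a + paths t n (edge x h l) b <= al * total h l.
  move=> lea leb yz; apply: (@le_trans _ _ ((x * y + z) * total h l)).
    by rewrite mulrDl; apply: lerD => //; rewrite -mulrA; apply: ler_wpM2l => //; exact: ltW.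
  exact: ler_wpM2r.
have leA1 : paths t n (edge x h l) a <= 1 * total h l by rewrite mul1r.
have leB1 : paths t n (edge x h l) b <= 1 * total h l by rewrite mul1r.
(* This saving on the paths from [a] leaves room for the trivial bound on those from [b]. *)
have quick : paths t n (edge x h l) a <= q^-1 * total h l ->
    x * paths t n (edge x h l) a + paths t n (edge x h l) b <= al * total h l.
  by move=> le; exact: combine le leB1 quick_le.
have q0V : 0 <= q^-1 by rewrite invr_ge0 ltW.
have p0V : 0 <= p^-1 by rewrite invr_ge0 ltW.
have al0V : 0 <= al^-1 by rewrite invr_ge0 ltW.
have [/and3P[bt /eqP hb /eqP lb]|b_alive] := boolP [&& b != t, h b == None & l b == None].
  apply: (combine 1 0) => //; last by rewrite mulr1 addr0.
  by apply: bound_start => //; rewrite /start (negPf bt) hb lb mul0r.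
have weight_b : b != t -> q <= weight h l b.
  move=> bt; move: b_alive; rewrite bt /weight /=.
  by case: (h b) => [w|]; case: (l b) => [w'|] //= _; rewrite (le_trans qp).
have [/forallP orph_b|] := boolP [forall v, (h v != Some b) && (l v != Some b)].
  have [bt|bt] := eqVneq b t.
    rewrite bt in orph_b ab; apply: (combine 0 1) => //; last by rewrite mulr0 add0r.
    by rewrite (orphan_sink orph_b ab) mul0r.
  apply: quick; apply: (bound_orphan1 (b := b)) => //.
  by rewrite mulrC ler_pdivlMr // mul1r weight_b.
rewrite negb_forall => /existsP[d0]; rewrite negb_and !negbK => d0P.
have drop_self f v : f v != Some a -> drop a f v = f v.
  by move=> fv; rewrite /drop (negPf fv).
have hl_excl v u : h v = Some u -> l v != Some u.
  move=> hv; have /and3P[_ _ /implyP hl] := nl v.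
  by apply/eqP => lv; have := hl; rewrite hv lv eqxx => /(_ isT).
have [/existsP[c /eqP hc]|] := boolP [exists c, h c == Some a].
  apply: quick; apply: (bound_loss (c := c)) => //.
    by apply: contra_eq_neq hc => ->; have /and3P[] := nl a.
  have hc' : drop a h c = None by rewrite /drop hc eqxx.
  rewrite /weight hc' hc drop_self ?(hl_excl _ _ hc) //.
  case: (l c) => [w|]; last by rewrite mulrC ler_pdivlMr // mul1r.
  by rewrite -ler_pdivrMr.
rewrite negb_exists => /forallP ha.
have [/existsP[c /andP[/eqP lc /eqP hc]]|] := boolP [exists c, (l c == Some a) && (h c == None)].
  apply: quick; apply: (bound_loss (c := c)) => //.
    by apply: contra_eq_neq lc => ->; have /and3P[_ + _] := nl a.
  have -> : weight (drop a h) (drop a l) c = 1 by rewrite /weight drop_self hc // /drop lc eqxx.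
  by rewrite /weight hc lc mulVf // gt_eqF.
rewrite negb_exists => /forallP la'.
have la c : l c == Some a -> h c != None.
  by move=> lc; have := la' c; rewrite lc.
have [/andP[at_ /eqP ha0]|a_ok] := boolP ((a != t) && (h a == None)).
  apply: quick; apply: bound_start => //; rewrite /start /weight (negPf at_) ha0.
  by case: (l a) => [w|]; rewrite ?mulr1 // mulVf ?gt_eqF.
have ha0 : a != t -> h a != None.
  by move=> at_; move: a_ok; rewrite at_.
have [D0|] := boolP [forall c, l c != Some a].
  have orph_a : orphan h l a by move=> v; rewrite ha (forallP D0).
  have [a_t|at_] := eqVneq a t.
    rewrite a_t in orph_a ba; apply: (combine 1 0) => //; last by rewrite mulr1 addr0.
    by rewrite (orphan_sink orph_a ba) mul0r.
  have h0 := ha0 at_.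
  have [la0|la0] := eqVneq (l a) None.
    apply: (combine (x / p) p^-1) => //.
      apply: bound_start => //; first by rewrite mulr_ge0 // ltW.
      rewrite /start /weight (negPf at_) la0; case: (h a) h0 => // w _.
      by rewrite divfK // gt_eqF.
    apply: (bound_orphan1 (b := a)) => //.
    by rewrite /weight la0; case: (h a) h0 => // w _; rewrite mulVf // gt_eqF.
  apply: (combine 1 al^-1) => //; last by rewrite mulr1.
  apply: (bound_orphan1 (b := a)) => //.
  by rewrite /weight; case: (h a) h0 => // w _; case: (l a) la0 => // w' _; rewrite mulVf // gt_eqF.
rewrite negb_forall => /existsP[c]; rewrite negbK => /eqP lca.
have ca : c != a by apply: contra_eq_neq lca => ->; have /and3P[_ + _] := nl a.
have drop_light v : l v = Some a -> weight (drop a h) (drop a l) v <= rho * weight h l v.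
  move=> lv; apply: weight_light_lost; first by rewrite lv.
    by rewrite /drop lv eqxx.
  exact: drop_sub.
have leA_rho : paths t n (edge x h l) a <= rho * total h l.
  by apply: (bound_loss (c := c)) => //; exact: drop_light.
have [/existsP[d /eqP hd]|] := boolP [exists d, h d == Some b].
  have db : d != b by apply: contra_eq_neq hd => ->; have /and3P[] := nl b.
  have ld : drop b l d = l d by rewrite /drop (negPf (hl_excl _ _ hd)).
  have hd' : drop b h d = None by rewrite /drop hd eqxx.
  have [ld0|ld0] := eqVneq (l d) None.
    apply: (combine rho p^-1) => //; apply: (bound_loss (c := d)) => //.
    by rewrite /weight hd' ld ld0 hd mulVf // gt_eqF.
  apply: (combine rho (q / al)) => //; apply: (bound_loss (c := d)) => //.
    by rewrite mulr_ge0 // ltW.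
  by rewrite /weight hd' ld hd; case: (l d) ld0 => // w _; rewrite divfK // gt_eqF.
rewrite negb_exists => /forallP hb.
have ld0 : l d0 = Some b by move: d0P; rewrite (negPf (hb d0)) => /eqP.
set r := #|[pred v | l v == Some a]|.
have r0 : (0 < r)%N by apply/card_gt0P; exists c; rewrite inE lca.
(* All edges into [a] and [b] are light from here on; [d] supplies the extra factor [rho] of
   [split_bound]. *)
have final d : d != a -> l d != Some a ->
    (d != b /\ l d = Some b) \/ [/\ d = b, h b = None & l b != None] ->
    x * paths t n (edge x h l) a + paths t n (edge x h l) b <= al * total h l.
  move=> da lda dP.
  have leAz z : 0 <= z -> start h l a <= z * weight h l a ->
      paths t n (edge x h l) a <= rho ^+ r * z * total h l.
    move=> z0 sz.
    have -> : rho ^+ r * z = \prod_v ((if l v == Some a then rho else 1) * only a z v).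
      by rewrite big_split prod_only -big_mkcond prodr_const.
    have laa : (l a == Some a) = false by have /and3P[_ /negPf] := nl a.
    apply: bound_drop => // [v|v va|].
    - by rewrite mulr_ge0 ?only_ge0 //; case: ifP.
    - rewrite /only (negPf va) mulr1; case: ifP => [/eqP|_]; first exact: drop_light.
      by rewrite mul1r; apply: le_weight; exact: drop_sub.
    - by rewrite /only eqxx laa mul1r.
  have [a_t|at_] := eqVneq a t.
    have full := split_full r0.
    (* No path avoids the sink, hence [iw = 0]. *)
    have nota : a != t -> 1 <= 0 * weight h l a by rewrite a_t eqxx.
    have leb := split_bound wfhl ab ha hb la da lda dP (lexx 0) nota.
    apply: (combine (rho ^+ r * 1) _ _ leb).
      by apply: leAz => //; rewrite mul1r start_le_weight.
    apply: le_trans full; rewrite mulr1 lerD2l; apply: ler_wpM2l; first by rewrite exprn_ge0.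
    by rewrite lerD2r.
  have h0 := ha0 at_.
  have [la0|la0] := eqVneq (l a) None.
    apply: (combine _ _ _ _ (split_heavy r0)).
      apply: leAz; first by rewrite mulr_ge0 // ltW.
      rewrite /start /weight (negPf at_) la0; case: (h a) h0 => // w _.
      by rewrite divfK // gt_eqF.
    apply: split_bound dP _ _ => // _.
    by rewrite /weight la0; case: (h a) h0 => // w _; rewrite mulVf // gt_eqF.
  have := split_full r0; rewrite -[X in x * X](mulr1 (rho ^+ r)) => full.
  apply: (combine _ _ _ _ full).
    by apply: leAz => //; rewrite mul1r start_le_weight.
  apply: split_bound dP _ _ => // _.
  by rewrite /weight; case: (h a) h0 => // w _; case: (l a) la0 => // w' _; rewrite mulVf // gt_eqF.
have [/existsP[d /andP[da /eqP ld]]|] := boolP [exists d, (d != a) && (l d == Some b)].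
  apply: (final d) => //; first by rewrite ld (inj_eq Some_inj).
  left; split=> //; apply: contra_eq_neq ld => ->.
  by have /and3P[_ + _] := nl b.
rewrite negb_exists => /forallP lb.
have {}lb v : l v = Some b -> v = a.
  by move=> lv; have := lb v; rewrite lv eqxx andbT negbK => /eqP.
have lab : l a = Some b by rewrite -(lb d0 ld0).
have at_ : a != t by apply: contra_eq_neq lab => ->; rewrite lt.
(* A vertex [b] without heavy edge serves as its own [d]. *)
have [/andP[bt /eqP hb0]|] := boolP ((b != t) && (h b == None)).
  apply: (final b) => //.
    by apply/eqP => /eqP /la; rewrite hb0.
  right; split=> //; apply/eqP => lb0.
  by move: b_alive; rewrite bt hb0 lb0.
(* Now [a] is the only predecessor of [b], and [b] is the sink or has a heavy edge. *)
rewrite negb_and negbK => hbP.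
apply: quick; apply: (row_bound (b := b) (c := c)) => //; first exact: ha0.
  move=> bt; move: hbP; rewrite (negPf bt) /weight /=.
  by case: (h b) => [w|] //; case: (l b).
by move=> cb; apply: la; rewrite -cb lca.
Qed.

End LargeOutdegree.

(* These hypotheses hold for x = 1 and p = q = 2 / al. *)
Section SmallOutdegree.
Hypotheses (x_1 : x = 1) (p_q : p = q).
Hypothesis two_le : q^-1 + q^-1 <= al.
Hypothesis q_loss : q / al <= q^-1.
Hypothesis orphan_full : 1 + al^-1 <= al.

(** Each of the two counts is at most [q^-1 * total h l], unless its origin has no incoming edge and
    is full or the sink. Paths from the other vertex then never visit it: they save a factor [al],
    or do not exist. *)
Lemma pair_small h l a b : wf h l -> a != b ->
  x * paths t n (edge x h l) a + paths t n (edge x h l) b <= al * total h l.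
Proof.
move=> wfhl ab; rewrite x_1 mul1r -x_1.
have q0 : 0 < q := lt_le_trans ltr01 q1.
have al0 : 0 < al := lt_le_trans ltr01 al1.
have Wge0 := total_ge0 h l.
have q0V : 0 <= q^-1 by rewrite invr_ge0 ltW.
pose P := paths t n (edge x h l).
have half u : P u <= q^-1 * total h l \/
    (start h l u = al /\ forall v, (h v != Some u) && (l v != Some u)) \/
    (u = t /\ forall v, (h v != Some u) && (l v != Some u)).
  have [nl ht lt] := wfhl.
  have [/forallP orph|] := boolP [forall v, (h v != Some u) && (l v != Some u)].
    have [ut|ut] := eqVneq u t; first by right; right.
    have [full|nfull] := eqVneq (start h l u) al; first by right; left.
    left; apply: bound_start => //; move: nfull; rewrite /start /weight (negPf ut).
    case: (h u) => [w|]; case: (l u) => [w'|]; rewrite ?eqxx // => _.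
    - by rewrite p_q mulVf ?gt_eqF // x_1.
    - by rewrite mulVf ?gt_eqF.
    - by rewrite mulr1.
  rewrite negb_forall => /existsP[c]; rewrite negb_and !negbK => cu; left.
  have [/eqP hc|hc] := boolP (h c == Some u).
    have cnu : c != u by apply: contra_eq_neq hc => ->; have /and3P[] := nl u.
    apply: (bound_loss (c := c)) => //.
    have hc' : drop u h c = None by rewrite /drop hc eqxx.
    have lc' : drop u l c = l c.
      rewrite /drop ifN //; apply/eqP => lc; have /and3P[_ _ /implyP] := nl c.
      by rewrite hc lc eqxx => /(_ isT).
    rewrite /weight hc' lc' hc; case: (l c) => [w|]; first by rewrite -ler_pdivrMr.
    by rewrite p_q mulVf // gt_eqF.
  have lc : l c = Some u by move: cu; rewrite (negPf hc) => /eqP.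
  have cnu : c != u by apply: contra_eq_neq lc => ->; have /and3P[] := nl u.
  apply: (bound_loss (c := c)) => //.
  have lc' : drop u l c = None by rewrite /drop lc eqxx.
  have hc' : drop u h c = h c by rewrite /drop (negPf hc).
  rewrite /weight hc' lc' lc; case: (h c) => [w|].
    by rewrite p_q -ler_pdivrMr.
  by rewrite mulVf // gt_eqF.
have le1 u : P u <= total h l by exact: bound_weight.
suff main u v : u != v ->
    (start h l u = al /\ forall w, (h w != Some u) && (l w != Some u)) \/
    (u = t /\ forall w, (h w != Some u) && (l w != Some u)) -> P u + P v <= al * total h l.
  have [ha|ha] := half a; last exact: main.
  have [hb|hb] := half b; last by rewrite addrC; apply: main => //; rewrite eq_sym.
  by apply: le_trans (lerD ha hb) _; rewrite -mulrDl; apply: ler_wpM2r.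
move=> uv [[su orph]|[u_t orph]].
  have [ut|ut] := eqVneq u t.
    rewrite ut in orph; rewrite /P (orphan_sink (a := v)) ?addr0 //; last by rewrite -ut eq_sym.
    by apply: le_trans (le1 u) _; apply: ler_peMl.
  have leB : P v <= al^-1 * total h l.
    apply: (bound_orphan1 (b := u)) => //; [by rewrite eq_sym|by rewrite invr_ge0 ltW|].
    by rewrite mulrC ler_pdivlMr // mul1r -{1}su start_le_weight.
  apply: le_trans (lerD (le1 u) leB) _.
  by rewrite -[X in X + _]mul1r -mulrDl; apply: ler_wpM2r.
rewrite u_t in orph; rewrite /P (orphan_sink (a := v)) ?addr0 //; last by rewrite -u_t eq_sym.
by apply: le_trans (le1 u) _; apply: ler_peMl.
Qed.

End SmallOutdegree.

End Step.
(** After the first edge, [s] is isolated. The pair inequality is the induction step at a full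
    vertex; with at most one edge, [bound_weight] is enough. *)
Lemma paths_le_weight n :
  (forall m, (forall h l s, wf h l ->
      paths t m (edge x h l) s <= start h l s * \prod_(v | v != s) weight h l v) ->
    forall h l a b, wf h l -> a != b ->
      x * paths t m (edge x h l) a + paths t m (edge x h l) b <= al * total h l) ->
  forall h l s, wf h l ->
  paths t n (edge x h l) s <= start h l s * \prod_(v | v != s) weight h l v.
Proof.
move=> pair; elim: n => [|n IH] h l s wfhl.
  rewrite /= /start; case: eqP => [_|_] /=.
    rewrite mul1r; elim/big_rec: _ => // v y _ y1.
    by apply: mulr_ege1 => //; exact: weight_ge1.
  apply: mulr_ge0; last by apply: prodr_ge0 => v _; exact: weight_ge0.
  have al0 := le_trans ler01 al1; have x0 := le_trans ler01 x1.
  by case: (h s); case: (l s).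
have [->|st] := eqVneq s t.
  rewrite paths_sink /start eqxx mul1r; elim/big_rec: _ => // v y _ y1.
  by apply: mulr_ege1 => //; exact: weight_ge1.
rewrite /= (negPf st).
pose h' := drop s (mute s h); pose l' := drop s (mute s l).
have sub' f : subgraph (drop s (mute s f)) f.
  exact: (sub_trans (drop_sub _ _) (mute_sub _ _)).
have wf' : wf h' l' by apply: wf_sub wfhl _ _; exact: sub'.
have cutE : cut (edge x h l) s = edge x h' l'.
  apply/funext => v; apply/funext => u; rewrite /cut /edge /h' /l' /drop /mute.
  have [vs|vs] := eqVneq v s; first by rewrite /= mulr0 addr0.
  have [us|us] /= := eqVneq u s.
    have aux f : ((if f v == Some s then None else f v) == Some u) = false.
      by rewrite us; case: ifP.
    by rewrite !aux mulr0 addr0.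
  have aux f : (f v == Some u) = ((if f v == Some s then None else f v) == Some u).
    have [->|//] := eqVneq (f v) (Some s).
    by apply/eqP => -[su]; rewrite su eqxx in us.
  by rewrite -!aux.
rewrite cutE.
have sumE : \sum_u edge x h l s u * paths t n (edge x h' l') u =
    x * oapp (paths t n (edge x h' l')) 0 (h s) + oapp (paths t n (edge x h' l')) 0 (l s).
  have one f : \sum_u (f s == Some u)%:R * paths t n (edge x h' l') u =
      oapp (paths t n (edge x h' l')) 0 (f s).
    case: (f s) => [w|] /=; last by rewrite big1 // => u _; rewrite mul0r.
    rewrite (bigD1 w) //= eqxx mul1r big1 ?addr0 // => u uw.
    by rewrite (inj_eq Some_inj) eq_sym (negPf uw) mul0r.
  rewrite -!one mulr_sumr -big_split /=; apply: eq_bigr => u _.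
  by rewrite /edge mulrDl mulrA.
rewrite sumE.
have le_total : total h' l' <= \prod_(v | v != s) weight h l v.
  rewrite /total (bigD1 s) //= {1}/weight /h' /l' /drop /mute eqxx /= mul1r.
  by apply: ler_prod => v _; rewrite weight_ge0; apply: le_weight; exact: sub'.
have x0 := le_trans ler01 x1; have al0 := le_trans ler01 al1.
apply: (@le_trans _ _ (start h l s * total h' l')); last first.
  apply: ler_wpM2l => //; rewrite /start (negPf st).
  by case: (h s); case: (l s).
have le1 u := bound_weight IH u wf'.
rewrite /start (negPf st); have [nl _ _] := wfhl.
case hs: (h s) => [a|]; case ls: (l s) => [b|] /=.
- apply: pair => //; have /and3P[_ _] := nl s; rewrite hs ls.
  by apply: contraTneq => ->; rewrite eqxx.
- by rewrite addr0; apply: ler_wpM2l.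
- by rewrite mulr0 add0r mul1r.
- by rewrite mulr0 add0r mul0r.
Qed.

(** The sink weighs 1 and every other vertex at most [al], whence the exponent. *)
Lemma paths_le_power n :
  (forall m, (forall h l s, wf h l ->
      paths t m (edge x h l) s <= start h l s * \prod_(v | v != s) weight h l v) ->
    forall h l a b, wf h l -> a != b ->
      x * paths t m (edge x h l) a + paths t m (edge x h l) b <= al * total h l) ->
  forall h l s, wf h l -> paths t n (edge x h l) s <= al ^+ #|V|.-1.
Proof.
move=> pair h l s wfhl; apply: le_trans (paths_le_weight n pair s wfhl) _.
apply: (@le_trans _ _ (total h l)).
  rewrite /total [leRHS](bigD1 s) //=; apply: ler_wpM2r; last exact: start_le_weight.
  by apply: prodr_ge0 => v _; exact: weight_ge0.
have [_ ht lt] := wfhl; rewrite /total (bigD1 t) //= {1}/weight ht lt mul1r.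
apply: (@le_trans _ _ (\prod_(v | v != t) al)).
  apply: ler_prod => v _; rewrite weight_ge0 /weight /=.
  have q_al := le_trans qp pal; have al_ge1 := al1.
  by case: (h v) => [w|]; case: (l v) => [w'|].
by rewrite prodr_const cardC1.
Qed.

End Weights.

(** * The growth rate alpha *)

Section Alpha.
Variables (R : realFieldType).
Implicit Types x al y z : R.

(** The left side does not increase with [r]: the step from 1 to 2 is assumed, and the later ones
    follow since [rho <= 1]. *)
Lemma geometric_linear_le (c d rho : R) (r : nat) : 0 <= c -> 0 <= d -> 0 <= rho <= 1 ->
  rho * (c + d) <= 1 -> rho * (c + 2 * d) <= c + d -> (0 < r)%N ->
  rho ^+ r * (c + r%:R * d) <= 1.
Proof.
move=> c0 d0 /andP[rho0 rho1] le1 step; elim: r => // -[_ _|r IH _].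
  by rewrite expr1 mul1r.
apply: le_trans (IH isT); rewrite exprSr -mulrA; apply: ler_wpM2l; first by rewrite exprn_ge0.
have : r.+1%:R = r%:R + 1 :> R by rewrite -natr1.
have : r.+2%:R = r%:R + 2 :> R by rewrite -addn2 natrD.
move=> -> ->; have := ler0n R r; set m := r%:R => m0.
have : rho * (m * d) <= m * d by apply: ler_piMl => //; rewrite mulr_ge0.
by move=> le; nra.
Qed.

(** * Inequalities in [y = al^-1] and [z = al^-2] for [2 <= x] *)

Section Numerics.
Variables (x y : R).
Hypotheses (y0 : 0 < y) (xE : x = y^-1 - y) (x2 : 2 <= x).
Let z := y ^+ 2.
Let rho := 1 - z + z ^+ 2.

Let yV : y * y^-1 = 1. Proof. by rewrite divff // gt_eqF. Qed.

(** Equivalent to [y <= sqrt 2 - 1]; the rational bounds 21/50 on [y] and 9/50 on [z] come from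
    here. *)
Let y_le : 2 * y + y ^+ 2 <= 1.
Proof. by have := x2; rewrite xE -(ler_pM2l y0) mulrBr yV -expr2 mulrC; lra. Qed.

Let y_lt : y <= 21 / 50. Proof. by have := y_le; have := y0; nra. Qed.

Let z0 : 0 < z. Proof. by rewrite exprn_gt0. Qed.

Let z_lt : z <= 9 / 50. Proof. by rewrite /z; have := y_lt; have := y0; nra. Qed.

(** Linear relations between consecutive powers of [z], which let [lra] treat the powers as separate
    unknowns. *)
Let z_pow i : 0 <= z ^+ i.+1 <= 9 / 50 * z ^+ i.
Proof.
have zi : 0 <= z ^+ i by rewrite exprn_ge0 ?ltW.
by rewrite exprS mulr_ge0 ?(ltW z0) //= ler_wpM2r.
Qed.

Let rho0 : 0 < rho. Proof. by rewrite /rho; have := z0; have := z_lt; nra. Qed.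

Let rho1 : rho <= 1. Proof. by rewrite /rho; have := z0; have := z_lt; nra. Qed.

Let yx : y * x = 1 - z. Proof. by rewrite xE mulrBr yV -expr2. Qed.

Let z1 : 0 < 1 - z. Proof. by have := z_lt; lra. Qed.

Let x0 : 0 < x. Proof. exact: lt_le_trans x2. Qed.

(** Multiplied by [y], the left side takes the form [rho ^+ r * (c + r * d)] of
    [geometric_linear_le], whose conditions reduce to polynomial inequalities in [z]. *)
Lemma split_full_le r : (0 < r)%N -> x * rho ^+ r + rho ^+ r.+1 * (y + r%:R / x) <= y^-1.
Proof.
move=> r0; rewrite -(ler_pM2l y0) yV.
have -> : y * (x * rho ^+ r + rho ^+ r.+1 * (y + r%:R / x)) =
    rho ^+ r * ((1 - z + rho * z) + r%:R * (rho * z / (1 - z))).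
  rewrite exprS -yx /z; field; rewrite ?gt_eqF //.
have zz := z0; have zl := z_lt.
have d0 : 0 <= rho * z / (1 - z) by rewrite divr_ge0 ?mulr_ge0 ?ltW.
apply: geometric_linear_le => //; rewrite ?(ltW rho0) //.
- by rewrite /rho; nra.
- have -> : rho * (1 - z + rho * z + rho * z / (1 - z)) = 1 - z ^+ 2 *
      (1 - 5 * z + 6 * z ^+ 2 - 4 * z ^+ 3 + z ^+ 4) / (1 - z).
    by rewrite /rho; field; rewrite gt_eqF.
  rewrite gerBl; apply: divr_ge0; last exact: ltW.
  apply: mulr_ge0; first exact: sqr_ge0.
  by move: (z_pow 1) (z_pow 2) (z_pow 3) (z_pow 4) => /andP[? ?] /andP[? ?] /andP[? ?] /andP[? ?]; lra.
- rewrite -subr_ge0.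
  have -> : 1 - z + rho * z + rho * z / (1 - z) - rho * (1 - z + rho * z + 2 * (rho * z / (1 - z)))
     = ((1 - z + rho * z) * (1 - rho) * (1 - z) - rho * z * (2 * rho - 1)) / (1 - z).
    by field; rewrite gt_eqF.
  rewrite divr_ge0 ?(ltW z1) //.
  have -> : (1 - z + rho * z) * (1 - rho) * (1 - z) - rho * z * (2 * rho - 1) =
    z ^+ 2 * (1 - 5 * z + 7 * z ^+ 2 - 5 * z ^+ 3 + z ^+ 4) by rewrite /rho; ring.
  apply: mulr_ge0; first exact: sqr_ge0.
  by move: (z_pow 1) (z_pow 2) (z_pow 3) (z_pow 4) => /andP[? ?] /andP[? ?] /andP[? ?] /andP[? ?]; lra.
Qed.

Lemma split_heavy_le r : (0 < r)%N ->
  x * (rho ^+ r * ((1 - z) / rho)) + rho ^+ r.+1 * (y / rho + r%:R / x) <= y^-1.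
Proof.
move=> r0; rewrite -(ler_pM2l y0) yV.
have -> : y * (x * (rho ^+ r * ((1 - z) / rho)) + rho ^+ r.+1 * (y / rho + r%:R / x)) =
    rho ^+ r * (((1 - z) ^+ 2 / rho + z) + r%:R * (rho * z / (1 - z))).
  rewrite exprS -yx /z; field; rewrite ?gt_eqF //.
have zz := z0; have zl := z_lt.
have d0 : 0 <= rho * z / (1 - z) by rewrite divr_ge0 ?mulr_ge0 ?ltW.
apply: geometric_linear_le => //; rewrite ?(ltW rho0) //.
- by rewrite addr_ge0 ?divr_ge0 ?exprn_ge0 ?ltW.
- have -> : rho * ((1 - z) ^+ 2 / rho + z + rho * z / (1 - z)) =
    1 - z ^+ 2 * (1 - 4 * z + 3 * z ^+ 2 - z ^+ 3) / (1 - z).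
    rewrite [LHS](_ : _ = (1 - z) ^+ 2 + rho * z + rho ^+ 2 * z / (1 - z)).
      by rewrite /rho; field; rewrite gt_eqF.
    by field; rewrite ?gt_eqF.
  rewrite gerBl; apply: divr_ge0; last exact: ltW.
  apply: mulr_ge0; first exact: sqr_ge0.
  by move: (z_pow 1) (z_pow 2) (z_pow 3) (z_pow 4) => /andP[? ?] /andP[? ?] /andP[? ?] /andP[? ?]; lra.
- rewrite -subr_ge0.
  have -> : (1 - z) ^+ 2 / rho + z + rho * z / (1 - z)
      - rho * ((1 - z) ^+ 2 / rho + z + 2 * (rho * z / (1 - z)))
     = (((1 - z) ^+ 2 + z * rho) * (1 - rho) * (1 - z) - rho ^+ 2 * z * (2 * rho - 1)) / ((1 - z) * rho).
    by field; rewrite ?gt_eqF.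
  rewrite divr_ge0 ?mulr_ge0 ?(ltW z1) ?(ltW rho0) //.
  have -> : ((1 - z) ^+ 2 + z * rho) * (1 - rho) * (1 - z) - rho ^+ 2 * z * (2 * rho - 1)
    = z ^+ 2 * (1 - 6 * z + 12 * z ^+ 2 - 13 * z ^+ 3 + 7 * z ^+ 4 - 2 * z ^+ 5).
    by rewrite /rho; ring.
  apply: mulr_ge0; first exact: sqr_ge0.
  (* A tangent bound on [z ^+ 2]: near 9/50 the part [1 - 6 * z] is negative and the quadratic term
     has to compensate. *)
  have sq := sqr_ge0 (z - 9 / 50).
  by move: (z_pow 1) (z_pow 2) (z_pow 3) (z_pow 4) => /andP[? ?] /andP[? ?] /andP[? ?] /andP[? ?]; lra.
Qed.

Lemma paths_le_large (V : finType) (t : V) n (h l : V -> option V) s :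
  wf t h l -> paths t n (edge x h l) s <= y^-1 ^+ #|V|.-1.
Proof.
have zz := z0; have zl := z_lt; have yy := y_le; have yl := y_lt; have yp := y0.
have r0 := rho0; have r1 := rho1; have xp := x0.
have y'0 : 0 < y^-1 by rewrite invr_gt0.
have q0 : 0 < 1 + y by lra.
have ry0 : 0 < rho / y by rewrite divr_gt0.
have rhoE : rho / y / y^-1 = rho by rewrite invrK divfK ?gt_eqF.
have xp' : x / (rho / y) = (1 - z) / rho by rewrite -yx; field; rewrite ?gt_eqF.
have pV : (rho / y)^-1 = y / rho by rewrite invf_div.
have yz : y * y = z by rewrite /z expr2.
have le1 : 1 <= x by apply: le_trans x2; rewrite ler1n.
have le2 : 1 <= 1 + y by lra.
have le3 : 1 + y <= rho / y.
  by rewrite ler_pdivlMr // /rho mulrDl yz mul1r; move: (z_pow 1) => /andP[? ?]; lra.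
have le4 : x <= rho / y.
  by rewrite ler_pdivlMr // mulrC yx /rho; have := sqr_ge0 z; lra.
have le5 : rho / y <= y^-1 by rewrite -[leRHS]mul1r ler_wpM2r // ltW.
have qal : (1 + y) / y^-1 = y + z by rewrite invrK mulrDl mul1r yz.
apply: (paths_le_power le1 le2 le3 le4 le5) => m bound h' l' a b.
apply: (pair_large le1 le2 le3 le4 le5 bound); rewrite ?rhoE ?xp' ?pV ?qal ?invrK.
(* An equality, since [x / (1 + y) = y^-1 - 1]: [q] is the least value allowed by [quick_le]. *)
- rewrite -lerBrDr ler_pdivrMr // xE mulrBl mulrDr mul1r [_^-1 * y]mulrC yV; lra.
- by rewrite -[leRHS]mul1r ler_pdivlMr // -yz; nra.
- by rewrite xE subrK.
(* Another equality: [(x ^+ 2 + 1) / p <= al] determines the least possible [p]. *)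
- have -> : x * ((1 - z) / rho) + y / rho = y^-1 * ((1 - z) ^+ 2 + z) / rho.
    by rewrite -yx -yz; field; rewrite ?gt_eqF.
  rewrite (_ : (1 - z) ^+ 2 + z = rho); last by rewrite /rho; ring.
  by rewrite mulfK // gt_eqF.
- rewrite -(ler_pM2l y0) yV mulrDr mulrA yx [y * (y + z)]mulrDr yz /rho.
  rewrite -subr_ge0; have -> : 1 - ((1 - z) * (1 - z + z ^+ 2) + (z + y * z)) =
    z * (1 - y - 2 * z + z ^+ 2) by ring.
  by rewrite mulr_ge0 ?(ltW z0) //; have := sqr_ge0 z; lra.
- rewrite -(ler_pM2l y0) yV mulrDr mulrA yx mulrA yz.
  rewrite -lerBrDl ler_pdivrMr // /rho.
  rewrite -subr_ge0; have -> : (1 - (1 - z) * (1 - z + z ^+ 2)) * (1 - z + z ^+ 2) - z =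
    z * (1 - 4 * z + 5 * z ^+ 2 - 3 * z ^+ 3 + z ^+ 4) by ring.
  rewrite mulr_ge0 ?(ltW z0) //.
  by move: (z_pow 1) (z_pow 2) (z_pow 3) => /andP[? ?] /andP[? ?] /andP[? ?]; lra.
- rewrite mulrDr mulr1 mulrCA divff ?gt_eqF // mulr1 -[leRHS]mul1r ler_pdivlMr //.
  have -> : (1 - z + rho) * y * (1 + y) = (1 - z + rho) * (y + z) by rewrite -yz; ring.
  apply: (@le_trans _ _ ((1 - z + rho) * ((1 + z) / 2))).
    apply: ler_wpM2l; first by rewrite addr_ge0 ?ltW.
    by rewrite /z; lra.
  rewrite /rho; move: (z_pow 1) (z_pow 2) => /andP[? ?] /andP[? ?]; lra.
- by rewrite -[leLHS]mul1r ler_pdivrMr // /rho -yz; nra.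
- by move=> r; exact: split_full_le.
- by move=> r; exact: split_heavy_le.
Qed.

End Numerics.

Lemma paths_le_small (V : finType) (t : V) n (al : R) (h l : V -> option V) s :
  0 < al -> al ^+ 2 = al + 1 -> wf t h l ->
  paths t n (edge 1 h l) s <= al ^+ #|V|.-1.
Proof.
move=> al0 alE; rewrite expr2 in alE.
(* Here [al] is the golden ratio. *)
have al1 : 8 / 5 <= al by nra.
have al2 : al <= 17 / 10 by nra.
have alV : al * al^-1 = 1 by rewrite divff // gt_eqF.
have le2 : 1 <= 2 / al by rewrite ler_pdivlMr //; lra.
have le5 : 2 / al <= al by rewrite ler_pdivrMr //; lra.
apply: (paths_le_power (lexx 1) le2 (lexx _) le2 le5) => m bound h' l' a b.
apply: (pair_small (lexx 1) le2 (lexx _) le2 le5 bound) => //.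
- by rewrite invf_div; lra.
- rewrite invf_div ler_pdivrMr // ler_pdivrMr //; nra.
- have -> : al^-1 = al - 1; last by lra.
  apply: (mulfI (lt0r_neq0 al0)).
  by rewrite alV mulrBr alE mulr1; ring.
Qed.

End Alpha.

Lemma paths_le_root (R : realFieldType) (V : finType) (t : V) n (k : nat) (al : R)
    (e : V -> V -> R) s :
  (2 <= k)%N -> 0 < al -> al ^+ 2 = (k%:R - 1) * al + 1 -> (2 <= #|V|)%N ->
  nonneg e -> (forall v u, e v u <= k%:R - 1) -> (forall v, \sum_u e v u <= k%:R) ->
  paths t n e s <= al ^+ #|V|.-1.
Proof.
move=> k2 al0 alE V2 e0 e_le e_sum; set x : R := k%:R - 1 in alE e_le.
have k2R : 2 <= k%:R :> R by rewrite ler_nat.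
have x1 : 1 <= x by rewrite /x; lra.
have esum' v : \sum_u e v u <= x + 1 by rewrite subrK.
have [h [l [hl le_hl]]] := paths_extremal t x1 V2 n s e0 e_le esum'.
apply: (le_trans le_hl).
(* Loops and edges leaving the sink lie on no path. *)
pose clean f v : option V := if (v == t) || (f v == Some v) then None else f v.
apply: (@le_trans _ _ (paths t n (edge x (clean h) (clean l)) s)).
  apply: le_paths; try exact: edge_ge0.
  move=> v u vt uv us; rewrite /edge /clean (negPf vt) /=.
  have aux f : (f v == Some u) = ((if f v == Some v then None else f v) == Some u).
    have [->|//] := eqVneq (f v) (Some v).
    by rewrite (inj_eq Some_inj) eq_sym (negPf uv).
  by rewrite -!aux.
have wf_clean : wf t (clean h) (clean l).
  split=> [v||]; rewrite /clean ?eqxx //.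
  case: (v == t) => //=; case: ifP => hv; case: ifP => lv /=; 
    by rewrite ?hv ?lv ?eqxx ?implybT ?implybb ?(negPf (hl v)).
have [k_2|k3] := eqVneq k 2%N.
  have x_1 : x = 1 by rewrite /x k_2; lra.
  by rewrite x_1 in alE *; apply: paths_le_small => //; rewrite alE mul1r.
have alV : al^-1 = al - x.
  by apply: (mulfI (lt0r_neq0 al0)); rewrite divff ?gt_eqF // mulrBr -expr2 alE; ring.
rewrite -[al]invrK; apply: paths_le_large => //; first by rewrite invr_gt0.
  by rewrite invrK alV; ring.
have : 3 <= k%:R :> R by rewrite ler_nat ltn_neqAle eq_sym k3.
by rewrite /x; lra.
Qed.

(** * Lassos *)

Section Keys.
Variables (S A : finType) (succ : S -> A -> S) (a0 : A).
Implicit Types (U : seq S) (p : S -> A) (s v u : S).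

(* At a non-branching state all actions lead to the same successor; keys forget which
   one is chosen there. *)
Definition branching s := [exists a, succ s a != succ s a0].

Definition label s a := if branching s then a else a0.

Definition labels s := if branching s then enum A else [:: a0].

Lemma succ_label s a : succ s (label s a) = succ s a.
Proof.
rewrite /label; case: ifPn => //; rewrite negb_exists => /forallP /(_ a).
by rewrite negbK => /eqP.
Qed.

(** The walk stops at the first repeated state, so the key reads off the lasso; [n] is fuel, for
    which [#|S|] suffices when [U] is empty. *)
Fixpoint key n U p s : seq A :=
  if n is n'.+1 then
    if s \in U then [::] else label s (p s) :: key n' (s :: U) p (succ s (p s))
  else [::].

Fixpoint keys n U s : seq (seq A) :=
  if n is n'.+1 then
    if s \in U then [:: [::]] else
    flatten [seq [seq a :: w | w <- keys n' (s :: U) (succ s a)] | a <- labels s]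
  else [:: [::]].

Lemma key_keys n U p s : key n U p s \in keys n U s.
Proof.
elim: n U s => [|n IH] U s //=; case: ifP => // _.
apply/flatten_mapP; exists (label s (p s)).
  by rewrite /labels /label; case: ifP => _; rewrite ?mem_enum ?inE.
by apply/mapP; exists (key n (s :: U) p (succ s (p s))); rewrite // succ_label.
Qed.

(** Equal keys make both walks follow the same lasso, whose states form [X]. The invariant on the
    visited list [U] is that successors stay in [U] or equal the current state [s]. *)
Lemma key_closed n U p p' s (same : pred S) : uniq U -> (#|S| <= size U + n)%N ->
  (forall v, ~~ branching v -> same v) ->
  (forall v, p v = p' v -> same v) ->
  key n U p s = key n U p' s ->
  (forall v, v \in U -> same v && ((succ v (p v) \in U) || (succ v (p v) == s))) ->
  exists X : {set S}, {subset s :: U <= X} /\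
    forall v, v \in X -> same v && (succ v (p v) \in X).
Proof.
move=> + + same_un same_eq; elim: n U s => [|n IH] U s uU szU eq_key closed.
  have sU : s \in U.
    have : [set x in U] == [set: S].
      by rewrite eqEcard subsetT cardsT cardsE (card_uniqP uU) -(addn0 (size U)).
    by move=> /eqP/setP/(_ s); rewrite !inE.
  exists [set x in U]; split=> v; rewrite !inE; first by case/predU1P => [->|].
  by move=> vU; have := closed v vU; case: (_ =P s) => [->|]; rewrite ?sU ?orbF.
have [sU|sU] := boolP (s \in U).
  exists [set x in U]; split=> v; rewrite !inE; first by case/predU1P => [->|].
  by move=> vU; have := closed v vU; case: (_ =P s) => [->|]; rewrite ?sU ?orbF.
move: eq_key => /=; rewrite (negPf sU) => -[eq_label eq_rest].
have eq_succ : succ s (p s) = succ s (p' s).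
  by rewrite -succ_label eq_label succ_label.
have [||||X [sX closedX]] := IH (s :: U) (succ s (p s)).
- by rewrite /= sU.
- by rewrite /= addSnnS.
- by rewrite eq_rest eq_succ.
- move=> v; rewrite inE => /orP[/eqP ->|vU].
    rewrite eqxx orbT andbT; have [bs|] := boolP (branching s); last exact: same_un.
    by apply: same_eq; move: eq_label; rewrite /label bs.
  have /andP[-> /orP[succU|/eqP ->]] /= := closed v vU.
    by rewrite inE succU orbT.
  by rewrite inE eqxx.
by exists X; split=> // v vU; apply: sX; rewrite inE vU orbT.
Qed.

(** * Counting keys by simple paths *)

Section KeyCount.
Variable R : realFieldType.

Definition mult v u : R := (count (fun a => succ v a == u) (labels v))%:R.

Definition cuts U (e : S -> S -> R) v u := if (v \in U) || (u \in U) then 0 else e v u.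

Lemma mult_ge0 : nonneg mult. Proof. by move=> v u; exact: ler0n. Qed.

Lemma cuts_ge0 U : nonneg (cuts U mult).
Proof. by move=> v u; rewrite /cuts; case: ifP => // _; exact: mult_ge0. Qed.

Lemma cut_cuts U s : cut (cuts U mult) s = cuts (s :: U) mult.
Proof.
apply/funext => v; apply/funext => u; rewrite /cut /cuts !inE.
by case: (v == s); case: (u == s); rewrite ?orbT ?if_same.
Qed.

Lemma sum_labels v (F : S -> R) :
  \sum_(a <- labels v) F (succ v a) = \sum_u mult v u * F u.
Proof.
rewrite (partition_big (succ v) predT) //=; apply: eq_bigr => u _.
rewrite (eq_bigr (fun=> F u)) => [|a /eqP <- //].
by rewrite big_const_seq iter_addr addr0 /mult mulr_natl.
Qed.

Lemma size_labels v : (0 < #|A|)%N -> (size (labels v) <= #|A|)%N.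
Proof. by rewrite /labels => A0; case: ifP => _ //; rewrite -cardE. Qed.

Lemma sum_mult v : \sum_u mult v u = (size (labels v))%:R.
Proof.
have := sum_labels v (fun=> 1); under [in RHS]eq_bigr do rewrite mulr1.
by move=> <-; rewrite big_const_seq iter_addr addr0 count_predT.
Qed.

(** At a branching state some action leads elsewhere; at any other state there is only one label. *)
Lemma mult_le v u : (2 <= #|A|)%N -> mult v u <= #|A|%:R - 1.
Proof.
move=> A2; rewrite lerBrDr natr1 ler_nat /mult /labels; case: ifPn; last first.
  by move=> _; apply: leq_trans A2; rewrite /= addn0 ltnS leq_b1.
move=> /existsP[a ab]; rewrite cardE -(count_predC (fun a => succ v a == u)) -addn1 leq_add2l.
rewrite -has_count; apply/hasP.
have [au|au] := boolP (succ v a == u).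
  by exists a0; rewrite ?mem_enum //= -(eqP au) eq_sym.
by exists a; rewrite ?mem_enum.
Qed.

(* Every key is a path followed by one last edge, into a state already visited. *)
Lemma size_keys n U s : (0 < #|A|)%N -> s \notin U ->
  (size (keys n U s))%:R <= #|A|%:R * \sum_t paths t n (cuts U mult) s.
Proof.
move=> A0; elim: n U s => [|n IH] U s sU /=.
  rewrite (bigD1 s) //= eqxx big1 ?addr0 ?mulr1 ?ler1n // => t ts.
  by rewrite eq_sym (negPf ts).
rewrite (negPf sU) size_flatten /shape -map_comp sumnE big_map natr_sum.
under eq_bigr do rewrite /= size_map.
set W := cuts (s :: U) mult.
have W0 : nonneg W by exact: cuts_ge0.
pose G u : R := if u \in s :: U then 0 else \sum_t paths t n W u.
(* The 1 pays for an edge closing the lasso; summed over the labels it becomes the summand [t = s],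
   the empty path. *)
apply: (@le_trans _ _ (\sum_(a <- labels s) (1 + #|A|%:R * G (succ s a)))).
  apply: ler_sum => a _; rewrite /G; case: ifP => [vis|/negbT nvis].
    by case: n {IH G} => [|n] /=; rewrite ?vis mulr0 addr0.
  by apply: le_trans (IH _ _ nvis) _; rewrite lerDr.
rewrite big_split /= big_const_seq iter_addr addr0 count_predT -mulr_sumr sum_labels.
apply: (@le_trans _ _ (#|A|%:R + #|A|%:R * \sum_u mult s u * G u)).
  by rewrite lerD2r ler_nat size_labels.
rewrite -[X in X + _]mulr1 -mulrDr; apply: ler_wpM2l; first exact: ler0n.
rewrite [leRHS](bigD1 s) //= eqxx lerD2l.
under [leRHS]eq_bigr => t ts do rewrite eq_sym (negPf ts) cut_cuts -/W.
rewrite exchange_big /=; apply: ler_sum => u _.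
rewrite -mulr_sumr /G /cuts (negPf sU) /=; case: ifP => [vis|nvis].
  rewrite mulr0 mulr_ge0 //; first by case: ifP => // _; exact: mult_ge0.
  by apply: sumr_ge0 => t _; exact: paths_ge0.
have uU : (u \in U) = false by move: nvis; rewrite inE => /norP[_ /negPf].
rewrite uU; apply: ler_wpM2l; first exact: mult_ge0.
rewrite [leLHS](bigD1 s) //= paths_unreachable_sink ?add0r //.
  by move: nvis; rewrite inE => /norP[].
by move=> v _; rewrite /W /cuts mem_head orbT.
Qed.

Lemma size_keys_le n s (al : R) : (2 <= #|A|)%N -> (2 <= #|S|)%N -> 0 < al ->
  al ^+ 2 = (#|A|%:R - 1) * al + 1 ->
  (size (keys n [::] s))%:R <= #|A|%:R * (#|S|%:R * al ^+ #|S|.-1).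
Proof.
move=> A2 S2 al0 alE; have A0 : (0 < #|A|)%N by exact: ltn_trans A2.
have sN : s \notin ([::] : seq S) by [].
apply: le_trans (size_keys n A0 sN) _; apply: ler_wpM2l; first exact: ler0n.
rewrite -[X in X * _](_ : \sum_(t : S) 1 = _); last by rewrite sumr_const.
rewrite mulr_suml; apply: ler_sum => t _; rewrite mul1r.
have -> : cuts [::] mult = mult by apply/funext => v; apply/funext => u.
apply: (@paths_le_root R S t n #|A| al mult s) => //; first by move=> *; exact: mult_le.
by move=> v; rewrite sum_mult ler_nat size_labels.
Qed.

End KeyCount.
End Keys.

(** * Runs of policy iteration *)

Section Runs.
Variables (R : realType) (S A : finType) (M : mdp R S A) (a0 : A).
Hypothesis detM : deterministic M.
Implicit Types (p : policy S A) (s v : S) (a : A).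

Definition next s a : S := odflt s [pick s' | trans M s a s' == 1].

Lemma trans_next s a s' : trans M s a s' = (s' == next s a)%:R.
Proof.
have next1 : trans M s a (next s a) = 1.
  rewrite /next; case: pickP => [u /eqP //|none]; have := trans_sum1 M s a.
  rewrite big1 => [|u _]; first by move/eqP; rewrite eq_sym oner_eq0.
  by case: (detM s a u) => // t1; have := none u; rewrite t1 eqxx.
have [->|ne] := eqVneq s' (next s a); first exact: next1.
case: (detM s a s') => // t1; have := trans_sum1 M s a.
rewrite (bigD1 (next s a)) //= (bigD1 s') //= next1 t1 => /eqP.
rewrite -subr_eq0 addrAC subrr add0r => /eqP sum0.
have : 0 <= \sum_(i | (i != next s a) && (i != s')) trans M s a i.
  by apply: sumr_ge0 => u _; have /andP[] := trans_itv M s a u.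
by lra.
Qed.

Lemma lookahead_next V s a : lookahead M V s a = reward M s a + discount M * V (next s a).
Proof.
rewrite /lookahead (bigD1 (next s a)) //= trans_next eqxx mul1r big1 ?addr0 // => u une.
by rewrite trans_next (negPf une) mul0r.
Qed.

Lemma value_next p s :
  value M p s = reward M s (p s) + discount M * value M p (next s (p s)).
Proof.
by rewrite -lookahead_next; have [+ _] := projT2 (cid (bellman_exists_unique M p)); exact.
Qed.

(** Minimum principle: at a minimiser [u] of [D] on [X], [discount M * D u <= D u], and the discount
    is below 1. *)
Lemma discounted_ge0 (X : {set S}) (f : S -> S) (D : S -> R) :
  (forall v, v \in X -> f v \in X) ->
  (forall v, v \in X -> discount M * D (f v) <= D v) -> forall v, v \in X -> 0 <= D v.
Proof.
move=> fX leD v vX; have /andP[g0 g1] := discount_itv M.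
case: (@arg_minP _ _ S v (mem X) D) => // u uX umin.
apply: le_trans (umin v vX).
have := le_trans (ler_wpM2l g0 (umin _ (fX _ uX))) (leD _ uX).
nra.
Qed.

Lemma value_agree p p' (X : {set S}) :
  (forall v, v \in X -> next v (p v) \in X) ->
  (forall v, v \in X -> next v (p v) = next v (p' v)) ->
  (forall v, v \in X -> reward M v (p v) = reward M v (p' v)) ->
  forall v, v \in X -> value M p v = value M p' v.
Proof.
move=> closed eq_next eq_rew v vX; apply/eqP; rewrite -subr_eq0 eq_le; apply/andP; split.
  rewrite -oppr_ge0 opprB.
  apply: (@discounted_ge0 X (fun u => next u (p u)) (fun u => value M p' u - value M p u)) => // u uX.
  by rewrite (value_next p u) (value_next p' u) eq_rew // -eq_next // opprD addrACA subrr add0r mulrBr.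
apply: (@discounted_ge0 X (fun u => next u (p u)) (fun u => value M p u - value M p' u)) => // u uX.
by rewrite (value_next p u) (value_next p' u) eq_rew // -eq_next // opprD addrACA subrr add0r mulrBr.
Qed.

Lemma pi_step_switch p p' : pi_step M p p' ->
  (exists s, 0 < gain M p s (p' s)) /\ forall s, p' s = p s \/ 0 < gain M p s (p' s).
Proof.
move=> /existsP[I /andP[/and3P[In0 /subsetP Iimp _] /eqP ->]].
have sw s : (improve p I s = p s /\ forall a, (s, a) \notin I) \/ 0 < gain M p s (improve p I s).
  rewrite ffunE; case: pickP => [a sa|none]; last by left; split=> // a; rewrite none.
  by right; have := Iimp _ sa; rewrite inE.
split=> [|s]; last by case: (sw s) => [[]|]; [left|right].
have /set0Pn[[s a] sa] := In0; exists s.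
by case: (sw s) => // -[_ /(_ a)]; rewrite sa.
Qed.

Lemma gain_self p s : gain M p s (p s) = 0.
Proof. by rewrite /gain /qvalue lookahead_next -value_next subrr. Qed.

(** The increase of the value solves the evaluation equation of [p'] with the nonnegative gains as
    rewards. *)
Lemma value_mono p p' : pi_step M p p' -> forall s,
  value M p s <= value M p' s /\
  (0 < gain M p s (p' s) -> value M p s < value M p' s).
Proof.
move=> /pi_step_switch[_ sw].
have gain_ge0 s : 0 <= gain M p s (p' s).
  by case: (sw s) => [->|/ltW //]; rewrite gain_self.
have diff s : value M p' s - value M p s = gain M p s (p' s) +
    discount M * (value M p' (next s (p' s)) - value M p (next s (p' s))).
  by rewrite /gain /qvalue lookahead_next (value_next p' s); ring.
have ge0 s : 0 <= value M p' s - value M p s.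
  apply: (@discounted_ge0 [set: S] (fun u => next u (p' u)) (fun u => value M p' u - value M p u)) => // u _.
    by rewrite (diff u) lerDr.
move=> s; split=> [|gt0]; first by rewrite -subr_ge0.
rewrite -subr_gt0 diff; apply: ltr_wpDr => //.
by rewrite mulr_ge0 //; have /andP[] := discount_itv M.
Qed.

Notation branching := (branching next a0).

(** Turns the growth of a real reward into the growth of a number below [#|A|]. *)
Definition rank p s : nat := #|[set a | reward M s a < reward M s (p s)]|.

Lemma rank_lt p s : (rank p s < #|A|)%N.
Proof.
rewrite /rank -cardsT; apply: proper_card; rewrite properT.
by apply: contraTneq (in_setT (p s)) => <-; rewrite inE ltxx.
Qed.

Lemma next_unary s a a' : ~~ branching s -> next s a = next s a'.
Proof.
by rewrite negb_exists => /forallP un; have := un a; have := un a'; rewrite !negbK => /eqP -> /eqP.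
Qed.

(** When all actions share a successor, the gain is a difference of rewards. *)
Lemma reward_mono p p' s : pi_step M p p' -> ~~ branching s ->
  reward M s (p s) <= reward M s (p' s).
Proof.
move=> /pi_step_switch[_ /(_ s)[->//|]] + un.
rewrite /gain /qvalue lookahead_next (value_next p s) (next_unary (p' s) (p s) un).
lra.
Qed.

(* Along a run the action at a non-branching state only changes for a better reward, so
   the epoch never decreases, and it is constant only while those rewards are. *)
Definition epoch p : nat := \sum_(s | ~~ branching s) rank p s.

Lemma epoch_lt p : (0 < #|S|)%N -> (epoch p < #|S| * #|A|)%N.
Proof.
move=> S0; have A0 : (0 < #|A|)%N by apply/card_gt0P; exists a0.
apply: (@leq_ltn_trans (#|S| * #|A|.-1)); last by rewrite ltn_pmul2l // prednK.
rewrite -sum_nat_const /epoch [leqRHS](bigID (fun s => ~~ branching s)) /=.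
apply: leq_trans (leq_addr _ _); apply: leq_sum => s _.
by rewrite -ltnS prednK // rank_lt.
Qed.

Section Sequence.
Variables (m : nat) (p : nat -> policy S A).
Hypothesis steps : forall i, (i < m)%N -> pi_step M (p i) (p i.+1).

Lemma value_homo s i j : (i <= j <= m)%N -> value M (p i) s <= value M (p j) s.
Proof.
elim: j => [|j IH] /andP[ij jm]; first by move: ij; rewrite leqn0 => /eqP ->.
move: ij; rewrite leq_eqVlt => /orP[/eqP -> //|]; rewrite ltnS => ij.
by apply: le_trans (IH _) (value_mono (steps jm) s).1; rewrite ij ltnW.
Qed.

Lemma reward_homo s i j : ~~ branching s -> (i <= j <= m)%N ->
  reward M s (p i s) <= reward M s (p j s).
Proof.
move=> un; elim: j => [|j IH] /andP[ij jm]; first by move: ij; rewrite leqn0 => /eqP ->.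
move: ij; rewrite leq_eqVlt => /orP[/eqP -> //|]; rewrite ltnS => ij.
by apply: le_trans (IH _) (reward_mono (steps jm) un); rewrite ij ltnW.
Qed.

(** The equality case lets [leqif_sum] turn equal epochs into equal rewards at each non-branching
    state. *)
Lemma rank_homo s i j : ~~ branching s -> (i <= j <= m)%N ->
  (rank (p i) s <= rank (p j) s ?= iff (reward M s (p i s) == reward M s (p j s)))%N.
Proof.
move=> un ij; have le := reward_homo un ij.
have sub : [set a | reward M s a < reward M s (p i s)] \subset
           [set a | reward M s a < reward M s (p j s)].
  by apply/subsetP => a; rewrite !inE => /lt_le_trans; apply.
split; first exact: subset_leq_card.
apply/eqP/eqP => [eq_rank|eq_rew]; last by rewrite /rank eq_rew.
apply/eqP; rewrite eq_le le /= leNgt; apply/negP => lt.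
have eq_set : [set a | reward M s a < reward M s (p i s)] =
    [set a | reward M s a < reward M s (p j s)].
  by apply/eqP; rewrite eqEcard sub; apply: eq_leq; exact: esym eq_rank.
by move/setP: eq_set => /(_ (p i s)); rewrite !inE ltxx lt.
Qed.

Lemma epoch_reward i j : (i <= j <= m)%N -> epoch (p i) = epoch (p j) ->
  forall s, ~~ branching s -> reward M s (p i s) = reward M s (p j s).
Proof.
move=> ij eq_epoch s un.
have := leqif_sum (fun s un => rank_homo (s := s) un ij).
rewrite -/(epoch _) -/(epoch _) => -[_]; rewrite eq_epoch eqxx => /esym/forallP/(_ s).
by rewrite un /= => /eqP.
Qed.

Definition switched (i : nat) : S -> bool := fun s => 0 < gain M (p i) s (p i.+1 s).

(** Equal keys and epochs give [s] the same value under policies [i.+1] and [j.+1], yet values do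
    not decrease up to [j] and the switch at [j] raises this one strictly. *)
Lemma switched_key s i j : switched j s -> (i < j)%N -> (j < m)%N ->
  epoch (p i.+1) = epoch (p j.+1) ->
  key next a0 #|S| [::] (p i.+1) s = key next a0 #|S| [::] (p j.+1) s -> False.
Proof.
move=> sw ij jm eq_epoch eq_key.
have lij : (i.+1 <= j.+1 <= m)%N by rewrite ltnS (ltnW ij).
pose same v := (reward M v (p i.+1 v) == reward M v (p j.+1 v)) &&
  (next v (p i.+1 v) == next v (p j.+1 v)).
have [||||||X [sX closed]] := @key_closed S A next a0 #|S| [::] (p i.+1) (p j.+1) s same => //.
- by move=> v un; rewrite /same (next_unary _ (p j.+1 v) un) eqxx andbT; apply/eqP; exact: epoch_reward un.
- by move=> v; rewrite /same => ->; rewrite !eqxx.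
have sXX : s \in X by apply: sX; rewrite mem_head.
have eq_value : value M (p i.+1) s = value M (p j.+1) s.
  apply: value_agree sXX => v /closed/andP[/andP[/eqP ? /eqP ?]] //.
have := (value_mono (steps jm) s).2 sw.
have ijm : (i.+1 <= j <= m)%N by rewrite ij ltnW.
by rewrite -eq_value ltNge value_homo.
Qed.

(** Steps are coded injectively by a switched state, its key after the step and the epoch: [#|S|]
    states, [#|A| * #|S| * al ^+ #|S|.-1] keys for each, [#|S| * #|A|] epochs. *)
Lemma steps_le (al : R) : (2 <= #|A|)%N -> (2 <= #|S|)%N -> 0 < al ->
  al ^+ 2 = (#|A|%:R - 1) * al + 1 ->
  m%:R <= #|S|%:R ^+ 3 * #|A|%:R ^+ 2 * al ^+ #|S|.-1.
Proof.
move=> A2 S2 al0 alE.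
have S0 : (0 < #|S|)%N by exact: ltn_trans S2.
have sw (i : 'I_m) : {s | switched i s}.
  by apply: cid; have [] := pi_step_switch (steps (ltn_ord i)).
pose s_ i := sval (sw i).
pose code (i : 'I_m) : S * (seq A * nat) :=
  (s_ i, (key next a0 #|S| [::] (p i.+1) (s_ i), epoch (p i.+1))).
pose codes := [seq (s, w) | s <- enum S,
  w <- [seq (k, e) | k <- keys next a0 #|S| [::] s, e <- iota 0 (#|S| * #|A|)]].
have code_inj : injective code.
  move=> i j eq_code; have eq_s : s_ i = s_ j := congr1 fst eq_code.
  have eq_key : key next a0 #|S| [::] (p i.+1) (s_ i) = key next a0 #|S| [::] (p j.+1) (s_ j).
    exact: (congr1 (fun c : S * (seq A * nat) => c.2.1) eq_code).
  have eq_epoch : epoch (p i.+1) = epoch (p j.+1) .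
    exact: (congr1 (fun c : S * (seq A * nat) => c.2.2) eq_code).
  rewrite -eq_s in eq_key; have sj : switched j (s_ i) by rewrite eq_s; exact: (svalP (sw j)).
  case: (ltngtP i j) => [lt|lt|]; last exact: val_inj.
    by have := switched_key sj lt (ltn_ord j) eq_epoch eq_key.
  by have := switched_key (svalP (sw i)) lt (ltn_ord i) (esym eq_epoch) (esym eq_key).
have le_codes : (m <= size codes)%N.
  have codes_uniq : uniq [seq code i | i <- enum 'I_m] by rewrite map_inj_uniq ?enum_uniq.
  have sub : {subset [seq code i | i <- enum 'I_m] <= codes}.
    move=> _ /mapP[i _ ->]; apply/allpairsPdep; exists (s_ i), (code i).2.
    split=> //; first by rewrite mem_enum.
    apply/allpairsPdep; exists (code i).2.1, (code i).2.2; split=> //; first exact: key_keys.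
    by rewrite mem_iota /= add0n epoch_lt.
  by have := uniq_leq_size codes_uniq sub; rewrite size_map size_enum_ord.
apply: (@le_trans _ _ (size codes)%:R); first by rewrite ler_nat.
rewrite size_allpairs_dep sumnE big_map big_enum /= natr_sum.
have -> : #|S|%:R ^+ 3 * #|A|%:R ^+ 2 * al ^+ #|S|.-1 =
    \sum_(s : S) (#|A|%:R * (#|S|%:R * al ^+ #|S|.-1)) * (#|S| * #|A|)%:R.
  by rewrite sumr_const -mulr_natl natrM; ring.
apply: ler_sum => s _; rewrite size_allpairs size_iota natrM.
by apply: ler_wpM2r; [exact: ler0n|exact: size_keys_le].
Qed.

End Sequence.
End Runs.

(** * The bound for [alpha] *)

Lemma alpha_root (R : realType) (k : nat) :
  alpha R k ^+ 2 = (k%:R - 1) * alpha R k + 1.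
Proof.
rewrite /alpha; set x := k%:R - 1; have x4 : 0 <= x ^+ 2 + 4 by have := sqr_ge0 x; lra.
by have := sqr_sqrtr x4; set r := Num.sqrt _ => rE; field: rE.
Qed.

Lemma alpha_ge (R : realType) (k : nat) : (2 <= k)%N ->
  1 <= alpha R k /\ k%:R <= 2 * alpha R k.
Proof.
move=> k2; have k2R : 2 <= k%:R :> R by rewrite ler_nat.
have x4 : 0 <= (k%:R - 1 : R) ^+ 2 + 4 by have := sqr_ge0 (k%:R - 1 : R); lra.
have r_ge : k%:R - 1 <= Num.sqrt ((k%:R - 1 : R) ^+ 2 + 4).
  rewrite -[leLHS]ger0_norm; last by lra.
  by rewrite -sqrtr_sqr ler_wsqrtr // lerDl.
by rewrite /alpha; set r := Num.sqrt _ in r_ge *; have := alpha_root R k; split; lra.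
Qed.

Theorem corollary1 (R : realType) :
  (forall (n k : nat) (S A : finType) (M : mdp R S A),
     (2 <= n)%N -> (2 <= k)%N -> #|S| = n -> #|A| = k -> deterministic M ->
     (forall (p : policy S A) (ps : seq (policy S A)), pi_run M p ps ->
        (size (p :: ps))%:R <= 5 * n%:R ^+ 3 * k%:R ^+ 2 * alpha R k ^+ n.-1)
     /\ ~ (exists p : nat -> policy S A, forall i, pi_step M (p i) (p i.+1)))
  /\ (exists C : R, forall n k : nat, (2 <= n)%N -> (2 <= k)%N ->
        5 * n%:R ^+ 3 * k%:R ^+ 2 * alpha R k ^+ n.-1
          <= C * (n%:R ^+ 3 * k%:R * alpha R k ^+ n)).
Proof.
split; last first.
  (* One factor [k] is traded for [2 * alpha R k], which turns 5 into 10. *)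
  exists 10 => n k n2 k2; have [al1 k_le] := alpha_ge R k2.
  have -> : alpha R k ^+ n = alpha R k * alpha R k ^+ n.-1 by rewrite -exprS prednK // ltnW.
  have N0 : 0 <= n%:R ^+ 3 * k%:R * alpha R k ^+ n.-1.
    by rewrite !mulr_ge0 ?exprn_ge0 ?ler0n // (le_trans ler01).
  have -> : 5 * n%:R ^+ 3 * k%:R ^+ 2 * alpha R k ^+ n.-1 =
      (n%:R ^+ 3 * k%:R * alpha R k ^+ n.-1) * (5 * k%:R) by ring.
  have -> : 10 * (n%:R ^+ 3 * k%:R * (alpha R k * alpha R k ^+ n.-1)) =
      (n%:R ^+ 3 * k%:R * alpha R k ^+ n.-1) * (10 * alpha R k) by ring.
  by apply: ler_wpM2l => //; lra.
move=> n k S A M n2 k2 Sn Ak detM; have [al1 _] := alpha_ge R k2.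
have al0 : 0 < alpha R k by exact: lt_le_trans al1.
have [a0 _] : exists a : A, a \in A by apply/card_gt0P; rewrite Ak ltnW.
set B := n%:R ^+ 3 * k%:R ^+ 2 * alpha R k ^+ n.-1.
have steps_B m (q : nat -> policy S A) :
    (forall i, (i < m)%N -> pi_step M (q i) (q i.+1)) -> m%:R <= B.
  move=> steps; rewrite /B -Sn -Ak; apply: (steps_le a0 detM steps); rewrite ?Sn ?Ak //.
  exact: alpha_root.
(* A run of [m] steps lists [m + 1] policies, and [m + 1 <= 5 * B] follows from [m <= B] and
   [1 <= B]. *)
have B1 : 1 <= B.
  have ge1 i : (2 <= i)%N -> 1 <= i%:R :> R by move=> i2; rewrite ler1n ltnW.
  by apply: mulr_ege1; [apply: mulr_ege1|]; apply: exprn_ege1 => //; exact: ge1.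
split=> [p ps /andP[/(pathP p) steps _]|[q steps]].
  have := steps_B (size ps) (nth p (p :: ps)) steps.
  have -> : 5 * n%:R ^+ 3 * k%:R ^+ 2 * alpha R k ^+ n.-1 = 5 * B by rewrite /B !mulrA.
  by rewrite /= -natr1; lra.
have B0 : 0 <= B by exact: le_trans B1.
(* An infinite run would have more than [B] steps. *)
have := archi_boundP B0; rewrite ltNge => /negP; apply.
by apply: (steps_B _ q) => i _; exact: steps.
Qed.
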